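(* Let $V$ be a vertex operator algebra such that: (1) $V$ is $C_1$-cofinite; (2) there exists a positive integer $N$ such that $|\Re(n_1)-\Re(n_2)|\le N$ for the lowest weights $n_1$ and $n_2$ of any two irreducible $V$-modules and such that $A_N(V)$ is finite dimensional; (3) every irreducible $V$-module is $\mathbb R$-graded and $C_1$-cofinite as a $V$-module. Let $\mathcal C$ be the category of grading-restricted generalized $V$-modules. Then $\mathcal C$ is closed under $P(z)$-tensor products: for every $z\in\mathbb C^\times$ and all objects $W_1,W_2$ of $\mathcal C$, the $P(z)$-tensor product $W_1\boxtimes_{P(z)}W_2$ exists as an object of $\mathcal C$.
   Context: $V=\coprod_{n\in\mathbb Z}V_{(n)}$ is a vertex operator algebra over $\mathbb C$, $Y(u,x)=\sum_{n\in\mathbb Z}u_nx^{-n-1}$, $V_+=\coprod_{n>0}V_{(n)}$. Generalized modules: A generalized $V$-module is a $\mathbb C$-graded space $W=\coprod_{n\in\mathbb C}W_{[n]}$ with a vertex operator map $Y_W:V\otimes W\to W((x))$ satisfying all axioms for $V$-modules except the two grading-restriction conditions, and with $W_{[n]}$ required only to be the generalized eigenspace of $L(0)$ with eigenvalue $n$. It is lower truncated if $W_{[n]}=0$ when $\Re(n)$ is sufficiently negative; grading restricted if it is lower truncated and $\dim W_{[n]}<\infty$ for all $n$; a (ordinary) $V$-module if it is grading restricted and $L(0)$ acts semisimply. The lowest weight of an irreducible $V$-module $W$ is the $n_0$ with $W_{[n_0]}\ne0$ and $W=\coprod_{k\in\mathbb N}W_{[n_0+k]}$. $\overline W=\prod_nW_{[n]}$,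 and $\pi_n:\overline W\to W_{[n]}$ is the projection; a module map $\eta$ extends naturally to $\overline\eta$ on completions. Cofiniteness: $V$ is $C_1$-cofinite (in the sense of Li) if $V/C_1^a(V)$ is finite dimensional, $C_1^a(V)$ being the span of $u_{-1}v$ ($u,v\in V_+$) and $L(-1)v$ ($v\in V$). A $V$-module $W$ is $C_1$-cofinite if $W/C_1(W)$ is finite dimensional, $C_1(W)$ being the span of $u_{-1}w$ ($u\in V_+$, $w\in W$). $A_n(V)=V/O_n(V)$ is the (Zhu, Dong–Li–Mason) associative algebra with product induced by $u*_nv=\sum_{m=0}^n(-1)^m\binom{m+n}{n}\mathrm{Res}_x\,x^{-n-m-1}Y((1+x)^{L(0)+n}u,x)v$, where $O_n(V)$ is spanned by $\mathrm{Res}_x\,x^{-2n-2}Y((1+x)^{L(0)+n}u,x)v$ and $(L(-1)+L(0))u$ for $u,v\in V$. $P(z)$-intertwining maps: Let $W_1,W_2,W_3$ be generalized $V$-modules with vertex operator maps $Y_1,Y_2,Y_3$, and let $\delta(x)=\sum_{n\in\mathbb Z}x^n$ (binomials $(a+b)^n$ are expanded in nonnegative powers of $b$). A $P(z)$-intertwining map of type ${W_3\choose W_1W_2}$ is a linear map $I:W_1\otimes W_2\to\overline{W_3}$ such that for all $w_1,w_2$ and $n\in\mathbb C$, $\pi_{n-m}(I(w_1\otimes w_2))=0$ for $m\in\mathbb N$ sufficiently large, and for all $v\in V$, $$x_0^{-1}\delta\Big(\frac{x_1-z}{x_0}\Big)Y_3(v,x_1)I(w_1\otimes w_2)=z^{-1}\delta\Big(\frac{x_1-x_0}{z}\Big)I(Y_1(v,x_0)w_1\otimes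 w_2)+x_0^{-1}\delta\Big(\frac{z-x_1}{-x_0}\Big)I(w_1\otimes Y_2(v,x_1)w_2).$$ $P(z)$-tensor product: for $W_1,W_2\in\mathcal C$, a $P(z)$-tensor product in $\mathcal C$ is an object $W_1\boxtimes_{P(z)}W_2$ of $\mathcal C$ with a $P(z)$-intertwining map $\boxtimes_{P(z)}$ of type ${W_1\boxtimes_{P(z)}W_2\choose W_1W_2}$ such that for any object $W$ of $\mathcal C$ and any $P(z)$-intertwining map $I$ of type ${W\choose W_1W_2}$ there is a unique module map $\eta:W_1\boxtimes_{P(z)}W_2\to W$ with $I=\overline\eta\circ\boxtimes_{P(z)}$. *)

(* Defs.v *)
(* The complex numbers are R[i] for R : realType. *)
From HB Require Import structures.
From mathcomp Require Import all_boot all_order all_algebra.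
From mathcomp Require Import sesquilinear complex.
From mathcomp Require Import boolp classical_sets functions cardinality fsbigop.
From mathcomp Require Import reals.

Set Implicit Arguments.
Unset Strict Implicit.
Unset Printing Implicit Defensive.

Import Order.TTheory GRing.Theory Num.Theory.
Local Open Scope classical_set_scope.
Local Open Scope ring_scope.

Section LinearAlgebra.
Variables (K : fieldType) (W : lmodType K).

Definition lspan (S : set W) : set W :=
  [set w | exists s : seq (K * W),
      (forall p, p \in s -> S p.2) /\ w = \sum_(p <- s) p.1 *: p.2].

(* Meant for linear subspaces U: dim U < oo, resp. dim (W / U) < oo. *)
Definition fin_dim (U : set W) : Prop :=
  exists s : seq W, U `<=` lspan [set` s].

Definition fin_codim (U : set W) : Prop :=
  exists s : seq W, forall w, exists2 u, U u & lspan [set` s] (w - u).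

(* A decomposition of W as the direct sum of the images of the gproj i. *)
Record grading (I : choiceType) := Grading {
  gproj :> I -> {linear W -> W};
  gproj_idem : forall i w, gproj i (gproj i w) = gproj i w;
  gproj_orth : forall i j w, i != j -> gproj i (gproj j w) = 0;
  gproj_fin : forall w, finite_set [set i | gproj i w != 0];
  gproj_sum : forall w, w = \sum_(i \in [set: I]) gproj i w
}.

Definition homog (I : choiceType) (g : grading I) (i : I) : set W :=
  [set w | g i w = w].

End LinearAlgebra.

(* Throughout, \sum_(i \in A) is the sum of a finitely supported family; lower
   truncation makes every such sum below a finite one. *)

Section VertexAlgebra.
Variable R : realType.
Local Notation C := R[i].

Definition binz (n : int) (i : nat) : C :=
  (\prod_(j < i) (n%:~R - j%:R)) / (i`!)%:R.

(* The coefficient of a^(n-i) b^i in (a - b)^n, expanded in nonnegative powers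
   of b. *)
Definition subexp (n : int) (i : nat) : C := (-1) ^+ i * binz n i.

(* Y n u w stands for u_n w, where Y(u,x)w = sum_n (u_n w) x^(-n-1). *)
Definition vertex_map (V W : lmodType C) := int -> {bilinear V -> W -> W}.

(* The equality of the coefficients of x0^(-l-1) x1^(-m-1) x2^(-n-1) in
     x0^-1 delta((x1-x2)/x0) Y(u,x1) Y(v,x2) w
       - x0^-1 delta((x2-x1)/(-x0)) Y(v,x2) Y(u,x1) w
     = x2^-1 delta((x1-x0)/x2) Y(Y(u,x0)v,x2) w. *)
Definition jacobi (V W : lmodType C) (YV : vertex_map V V)
    (YW : vertex_map V W) : Prop :=
  forall (u v : V) (w : W) (l m n : int),
    (\sum_(i \in [set: nat])
        subexp l i *: YW (l + m - i%:Z) u (YW (n + i%:Z) v w))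
    - (\sum_(i \in [set: nat])
        ((-1) ^ l * subexp l i) *: YW (l + n - i%:Z) v (YW (m + i%:Z) u w))
    = \sum_(i \in [set: nat])
        subexp (i%:Z - m - 1) i *: YW (m + n - i%:Z) (YV (l + i%:Z) u v) w.

(* L(n) = omega_(n+1). *)
Definition vir (V W : lmodType C) (omega : V) (YW : vertex_map V W) (n : int)
    (w : W) : W := YW (n + 1) omega w.

Definition virasoro (V W : lmodType C) (omega : V) (c : C)
    (YW : vertex_map V W) : Prop :=
  let L := vir omega YW in
  forall (m n : int) (w : W),
    L m (L n w) - L n (L m w) =
    (m - n)%:~R *: L (m + n) w
    + (if m + n == 0 then ((m ^+ 3 - m)%:~R / 12%:R * c) *: w else 0).

(* The axioms on a vertex operator map that do not involve gradings. *)
Record vertex_action (V W : lmodType C) (YV : vertex_map V V) (vac omega : V)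
    (c : C) (YW : vertex_map V W) : Prop := VertexAction {
  va_truncation : forall u w, exists N : int, forall n, N <= n -> YW n u w = 0;
  va_vacuum : forall n w, YW n vac w = if n == -1 then w else 0;
  va_jacobi : jacobi YV YW;
  va_virasoro : virasoro omega c YW;
  (* Y(L(-1)u,x) = d/dx Y(u,x) *)
  va_derivative : forall n u w,
    YW n (vir omega YV (-1) u) w = (- n)%:~R *: YW (n - 1) u w
}.

Record voa := VOA {
  voa_sort :> lmodType C;
  voa_gr : grading voa_sort int;
  voa_Y : vertex_map voa_sort voa_sort;
  voa_vac : voa_sort;
  voa_omega : voa_sort;
  voa_charge : C;
  voa_action : vertex_action voa_Y voa_vac voa_omega voa_charge voa_Y;
  voa_lower : exists N : int, forall n v, n < N -> voa_gr n v = 0;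
  voa_findim : forall n, fin_dim (homog voa_gr n);
  voa_vac0 : homog voa_gr 0 voa_vac;
  voa_omega2 : homog voa_gr 2 voa_omega;
  voa_L0 : forall n v, homog voa_gr n v ->
    vir voa_omega voa_Y 0 v = n%:~R *: v;
  (* Y(v,x)1 is in V[[x]], with constant term v *)
  voa_creation : forall n v, 0 <= n -> voa_Y n v voa_vac = 0;
  voa_creation1 : forall v, voa_Y (-1) v voa_vac = v
}.

Section Modules.
Variable V : voa.

Record genmod := GenMod {
  gm_sort :> lmodType C;
  gm_gr : grading gm_sort C;
  gm_Y : vertex_map V gm_sort;
  gm_action :
    vertex_action (voa_Y V) (voa_vac V) (voa_omega V) (voa_charge V) gm_Y;
  gm_geneig : forall (n : C) (w : gm_sort),
    homog gm_gr n w <->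
    exists k : nat,
      iter k (fun x => vir (voa_omega V) gm_Y 0 x - n *: x) w = 0
}.

Definition lower_truncated (W : genmod) : Prop :=
  exists r : R, forall (n : C) (w : W), complex.Re n < r -> gm_gr W n w = 0.

Definition grading_restricted (W : genmod) : Prop :=
  lower_truncated W /\ forall n : C, fin_dim (homog (gm_gr W) n).

Definition L0_semisimple (W : genmod) : Prop :=
  forall w : W,
    lspan [set x : W | exists a : C, vir (voa_omega V) (gm_Y W) 0 x = a *: x] w.

Definition ordinary_module (W : genmod) : Prop :=
  grading_restricted W /\ L0_semisimple W.

Definition submodule (W : genmod) (S : set W) : Prop :=
  [/\ S 0,
      forall (a : C) x y, S x -> S y -> S (a *: x + y)
    & forall n (u : V) x, S x -> S (gm_Y W n u x)].

Definition irreducible_module (W : genmod) : Prop :=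
  [/\ ordinary_module W,
      exists w : W, w <> 0
    & forall S : set W, submodule S -> S = [set 0] \/ S = setT].

Definition lowest_weight (W : genmod) (n0 : C) : Prop :=
  (exists2 w : W, w <> 0 & homog (gm_gr W) n0 w) /\
  forall (n : C) (w : W), w <> 0 -> homog (gm_gr W) n w ->
    exists k : nat, n = n0 + k%:R.

Definition real_graded (W : genmod) : Prop :=
  forall (n : C) (w : W), w <> 0 -> homog (gm_gr W) n w -> complex.Im n = 0.

Definition vplus : set V :=
  [set u | forall n : int, n <= 0 -> voa_gr V n u = 0].

Definition C1a : set V :=
  lspan [set x | (exists u v, [/\ vplus u, vplus v & x = voa_Y V (-1) u v]) \/
                 (exists v, x = vir (voa_omega V) (voa_Y V) (-1) v)].

Definition C1_cofinite_voa : Prop := fin_codim C1a.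

Definition C1 (W : genmod) : set W :=
  lspan [set x | exists u (w : W), vplus u /\ x = gm_Y W (-1) u w].

Definition C1_cofinite (W : genmod) : Prop := fin_codim (@C1 W).

(* Res_x x^k Y((1+x)^(L(0)+n) u, x) v; the weight-h component u' of u
   contributes sum_j binz (h+n) j u'_(k+j) v. *)
Definition zhu_res (n : nat) (k : int) (u v : V) : V :=
  \sum_(h \in [set: int]) \sum_(j \in [set: nat])
    binz (h + n%:Z) j *: voa_Y V (k + j%:Z) (voa_gr V h u) v.

Definition On (n : nat) : set V :=
  lspan [set x | (exists u v, x = zhu_res n (- (2 * n + 2)%N%:Z) u v) \/
                 (exists u, x = vir (voa_omega V) (voa_Y V) (-1) u
                              + vir (voa_omega V) (voa_Y V) 0 u)].

(* dim A_n(V) < oo; the product of A_n(V) = V / O_n(V) plays no role in it. *)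
Definition An_fin_dim (n : nat) : Prop := fin_codim (On n).

(* An element of the completion, i.e. of the product of all the W_[n], is a
   function f with f n in W_[n]; the projection pi_n is the evaluation at n. *)
Definition in_completion (W : genmod) (f : C -> W) : Prop :=
  forall n, homog (gm_gr W) n (f n).

(* The action of v_k on the completion. *)
Definition completed_op (W : genmod) (k : int) (v : V) (f : C -> W) : C -> W :=
  fun n => \sum_(p \in [set: C]) gm_gr W n (gm_Y W k v (f p)).

(* The last field is the equality of the coefficients of x0^(-l-1) x1^(-m-1),
   projected by pi_n, in
     x0^-1 delta((x1-z)/x0) Y3(v,x1) I(w1 (x) w2)
     = z^-1 delta((x1-x0)/z) I(Y1(v,x0)w1 (x) w2)
       + x0^-1 delta((z-x1)/(-x0)) I(w1 (x) Y2(v,x1)w2). *)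
Record intertwining_map (z : C) (W1 W2 W3 : genmod)
    (I : {bilinear W1 -> W2 -> (C -> W3)}) : Prop := IntertwiningMap {
  im_completion : forall w1 w2, in_completion (I w1 w2);
  im_truncation : forall w1 w2 (n : C),
    exists M : nat, forall m : nat, (M <= m)%N -> I w1 w2 (n - m%:R) = 0;
  im_jacobi : forall (v : V) (w1 : W1) (w2 : W2) (l m : int) (n : C),
    \sum_(i \in [set: nat])
        (subexp l i * z ^+ i) *: completed_op (l + m - i%:Z) v (I w1 w2) n
    = (\sum_(i \in [set: nat])
        (subexp (i%:Z - m - 1) i * z ^ (m - i%:Z))
          *: I (gm_Y W1 (l + i%:Z) v w1) w2 n)
    + \sum_(i \in [set: nat])
        ((-1) ^ l * subexp l i * z ^ (l - i%:Z))
          *: I w1 (gm_Y W2 (m + i%:Z) v w2) n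
}.

Definition module_map (W1 W2 : genmod) (f : W1 -> W2) : Prop :=
  linear f /\ forall n (v : V) w, f (gm_Y W1 n v w) = gm_Y W2 n v (f w).

Definition completed_map (W1 W2 : genmod) (f : W1 -> W2) (g : C -> W1) :
  C -> W2 := fun n => f (g n).

(* P(z)-tensor products in the full subcategory of objects satisfying Obj. *)
Definition tensor_product (Obj : genmod -> Prop) (z : C) (W1 W2 T : genmod)
    (B : {bilinear W1 -> W2 -> (C -> T)}) : Prop :=
  [/\ Obj T,
      intertwining_map z B
    & forall (W : genmod) (I : {bilinear W1 -> W2 -> (C -> W)}),
        Obj W -> intertwining_map z I ->
        exists! eta : T -> W,
          module_map eta /\
          forall w1 w2, I w1 w2 = completed_map eta (B w1 w2)].

End Modules.
End VertexAlgebra.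

(* Main.v *)
From HB Require Import structures.
Require Import Defs.
From mathcomp Require Import all_boot all_order all_algebra.
From mathcomp Require Import sesquilinear complex generic_quotient ring_quotient.
From mathcomp Require Import boolp classical_sets functions cardinality fsbigop.
From mathcomp Require Import reals ring lra zify.

(* Call a weight n of a lower truncated module W lowest if W_[n] contains an
   L(0)-eigenvector killed by all weight-lowering modes.  The zero modes of the
   elements L(-2)^j 1 act on such a vector by a polynomial of degree j in n,
   whereas zero modes of O_N(V) act by 0; as A_N(V) is finite dimensional, the
   lowest weights lie in a finite set P, the roots of one polynomial.  Hence a
   nonzero grading-restricted W meets the sum of the W_[p], p in P, whose finite
   dimension thus bounds the length of W, and every object of the category is
   C_1-cofinite, being an iterated extension of irreducible modules.

   Let I be an intertwining map from W1 and W2 to T.  The Jacobi identity rewrites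
   I(u_(-1) w1, w2) and I(w1, u_(-1) w2) in terms of lower total weight, plus
   modes u_(-1-i) applied to I(w1, w2).  As the weights of T are bounded below
   by those in P, this expresses the components of I of degree in P by
   finitely many vectors, whose number does not depend on T.  So among all I one
   can choose one whose image generates a module T with the largest possible
   part in degrees P.  For any other I' into W', the submodule generated by
   (I, I') in T + W' is then the graph of a module map from T to W'. *)

Set Implicit Arguments.
Unset Strict Implicit.
Unset Printing Implicit Defensive.

Import Order.TTheory GRing.Theory Num.Theory.
Local Open Scope classical_set_scope.
Local Open Scope ring_scope.

(** * Finite sums, spans and gradings *)

(** The modules T that receive an intertwining map form a class, so what is maximized is a natural
    number: the dimension, in degrees P, of the submodule generated by the image. A maximum exists
    only if the bound is uniform, which is why the depth D, the list of words and the generators M1,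
    M2 are all fixed before T and I appear. This number is the right invariant for two reasons.
    Taking the part in degrees P is exact, so the submodule generated by (I, I'), which projects
    onto the one generated by I, has at least as many independent vectors there. And a nonzero
    submodule of a lower truncated module never misses these degrees, so a nonzero kernel of that
    projection would supply one vector more. Maximality thus kills the kernel, and no explicit model
    of the tensor product is needed. The hypothesis on irreducible modules concerns ordinary ones,
    while the simple pieces of an object are a priori only generalized modules. The gap closes
    because the L(0)-eigenvectors span a submodule. *)

Section FiniteSums.
Variables (A : zmodType) (I : choiceType).
Implicit Type x : I -> A.

Lemma fsum_seq x (r : seq I) : uniq r -> (forall i, x i != 0 -> i \in r) ->
  \sum_(i \in [set: I]) x i = \sum_(i <- r) x i.
Proof.
move=> ur xr; rewrite (fsbigE r)// => [|i _ ir].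
  by apply: eq_bigl => i; rewrite in_setT.
by apply/eqP; apply: contraNT ir => /xr.
Qed.

Lemma finite_support_seq x : finite_set [set i | x i != 0] ->
  exists2 r : seq I, uniq r & forall i, x i != 0 -> i \in r.
Proof.
move=> /finite_seqP[s sE]; exists (undup s); first exact: undup_uniq.
by move=> i xi; rewrite mem_undup; have : [set i | x i != 0] i by []; rewrite sE.
Qed.

Lemma fsum1 x i0 : (forall i, i != i0 -> x i = 0) ->
  \sum_(i \in [set: I]) x i = x i0.
Proof.
move=> x0; rewrite (@fsum_seq x [:: i0]) ?big_seq1// => i.
by rewrite inE; apply: contraNT => /x0 ->.
Qed.

Lemma fsum0 x : (forall i, x i = 0) -> \sum_(i \in [set: I]) x i = 0.
Proof. by move=> x0; apply: fsbig1 => i _; apply: x0. Qed.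

Lemma eq_fsum x y : x =1 y ->
  \sum_(i \in [set: I]) x i = \sum_(i \in [set: I]) y i.
Proof. by move=> /funext ->. Qed.

(** No finiteness is asked: a family of infinite support sums to 0 by convention, a case covered by
    [P 0]. *)
Lemma fsum_ind (P : A -> Prop) x : P 0 -> (forall u v, P u -> P v -> P (u + v)) ->
  (forall i, P (x i)) -> P (\sum_(i \in [set: I]) x i).
Proof. by move=> P0 PD Px; apply: big_ind. Qed.

End FiniteSums.

Lemma fsum_morph (A B : zmodType) (I : choiceType) (f : {additive A -> B})
    (x : I -> A) : finite_set [set i | x i != 0] ->
  f (\sum_(i \in [set: I]) x i) = \sum_(i \in [set: I]) f (x i).
Proof.
move=> /finite_support_seq[r ur xr]; rewrite (fsum_seq ur xr) raddf_sum.
rewrite (fsum_seq ur)// => i; apply: contra_neqT => ir.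
by rewrite (contraNeq (xr i) ir) raddf0.
Qed.

Lemma finite_support_nat (A : zmodType) (x : nat -> A) N :
  (forall i, (N <= i)%N -> x i = 0) -> finite_set [set i | x i != 0].
Proof.
move=> x0; apply: (@sub_finite_set _ _ [set` iota 0 N]) => //.
move=> i /=; rewrite mem_iota add0n => /eqP; case: ltnP => // /x0; tauto.
Qed.

Lemma fsum_nat (A : zmodType) (x : nat -> A) N :
  (forall i, (N <= i)%N -> x i = 0) ->
  \sum_(i \in [set: nat]) x i = \sum_(i < N) x i.
Proof.
move=> x0; rewrite (@fsum_seq _ _ _ (iota 0 N)) ?iota_uniq//.
  by rewrite -(big_mkord xpredT) /index_iota subn0.
by move=> i; rewrite mem_iota add0n; case: ltnP => // /x0 ->; rewrite eqxx.
Qed.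

Section Subspaces.
Variables (K : fieldType) (W : lmodType K).
Implicit Types S Q : set W.

Definition subspace S := S 0 /\ forall (a : K) x y, S x -> S y -> S (a *: x + y).

Section Closure.
Variables (S : set W) (subS : subspace S).
Lemma subspace0 : S 0. Proof. by case: subS. Qed.
Lemma subspaceZ a x : S x -> S (a *: x).
Proof. by move=> Sx; rewrite -[_ *: _]addr0; case: subS => S0; apply. Qed.
Lemma subspaceD x y : S x -> S y -> S (x + y).
Proof. by rewrite -{2}[x]scale1r; case: subS => S0; apply. Qed.
Lemma subspaceN x : S x -> S (- x).
Proof. by rewrite -scaleN1r; apply: subspaceZ. Qed.
Lemma subspaceB x y : S x -> S y -> S (x - y).
Proof. by move=> Sx /subspaceN; apply: subspaceD. Qed.
Lemma subspace_sum (I : Type) (r : seq I) (P : pred I) (F : I -> W) :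
  (forall i, P i -> S (F i)) -> S (\sum_(i <- r | P i) F i).
Proof.
by move=> SF; apply: big_ind => //; [exact: subspace0|exact: subspaceD].
Qed.
Lemma subspace_fsum (I : choiceType) (F : I -> W) :
  (forall i, S (F i)) -> S (\sum_(i \in [set: I]) F i).
Proof. exact: fsum_ind subspace0 subspaceD. Qed.
End Closure.

Lemma subspace_lspan S : subspace (lspan S).
Proof.
split; first by exists [::]; split => //; rewrite big_nil.
move=> a x y [s [sS ->]] [t [tS ->]].
exists ([seq (a * p.1, p.2) | p <- s] ++ t); split.
  by move=> p; rewrite mem_cat => /orP[/mapP[q /sS ? ->]//|/tS].
rewrite big_cat big_map scaler_sumr; congr (_ + _).
by apply: eq_bigr => p _; rewrite scalerA.
Qed.

Lemma lspan_gen S x : S x -> lspan S x.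
Proof.
move=> Sx; exists [:: (1, x)]; split; last by rewrite big_seq1 scale1r.
by move=> p; rewrite inE => /eqP ->.
Qed.

Lemma lspan_min S Q : subspace Q -> S `<=` Q -> lspan S `<=` Q.
Proof.
move=> subQ SQ _ [s [sS ->]]; rewrite big_seq; apply: subspace_sum => // p ps.
by apply: subspaceZ => //; apply/SQ/sS.
Qed.

Lemma lspan_mono S Q : S `<=` Q -> lspan S `<=` lspan Q.
Proof.
by move=> SQ; apply: lspan_min (subspace_lspan _) _ => x /SQ; apply: lspan_gen.
Qed.

Lemma lspan_seqP (s : seq W) w : lspan [set` s] w ->
  exists a : 'I_(size s) -> K, w = \sum_i a i *: s`_i.
Proof.
pose Q := [set w | exists a : 'I_(size s) -> K, w = \sum_i a i *: s`_i].
apply: (@lspan_min _ Q).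
  split; first by exists (fun=> 0); rewrite big1// => i _; rewrite scale0r.
  move=> c x y [a ->] [b ->]; exists (fun i => c * a i + b i).
  rewrite scaler_sumr -big_split; apply: eq_bigr => i _ /=.
  by rewrite scalerDl scalerA.
move=> x /= /(nthP 0)[i si <-]; exists (fun j => (j == i :> nat)%:R).
rewrite (bigD1 (Ordinal si))//= eqxx scale1r big1 ?addr0// => j.
by rewrite -val_eqE /= => /negPf ->; rewrite scale0r.
Qed.

Lemma lspan_cons x (s : seq W) w : lspan [set` x :: s] w <->
  exists a, lspan [set` s] (w - a *: x).
Proof.
have subs : subspace (lspan [set` s]) := subspace_lspan _.
have subxs : subspace (lspan [set` x :: s]) := subspace_lspan _.
split=> [|[a wa]]; last first.
  rewrite -[w](subrK (a *: x)); apply: subspaceD => //.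
    by apply: lspan_mono wa => y /= ys; rewrite inE ys orbT.
  by apply: subspaceZ => //; apply: lspan_gen; rewrite /= inE eqxx.
pose Q := [set w | exists a, lspan [set` s] (w - a *: x)].
apply: (@lspan_min _ Q).
  split; first by exists 0; rewrite scale0r subr0; apply: subspace0.
  move=> c y t [a ya] [b tb]; exists (c * a + b).
  have -> : c *: y + t - (c * a + b) *: x = c *: (y - a *: x) + (t - b *: x).
    by rewrite scalerBr scalerDl scalerA opprD addrACA.
  by apply: subspaceD => //; apply: subspaceZ.
move=> y /=; rewrite inE => /orP[/eqP ->|ys].
  by exists 1; rewrite scale1r subrr; apply: subspace0.
by exists 0; rewrite scale0r subr0; apply: lspan_gen.
Qed.

Lemma subspaceI S Q : subspace S -> subspace Q -> subspace (S `&` Q).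
Proof.
move=> [S0 SP] [Q0 QP]; split=> // a x y [? ?] [? ?].
by split; [apply: SP|apply: QP].
Qed.

Lemma subspace_basis (s : seq W) S : subspace S -> S `<=` lspan [set` s] ->
  exists2 t : seq W, [set` t] `<=` S & S `<=` lspan [set` t].
Proof.
elim: s S => [|x s IH] S subS Ss.
  by exists [::] => // w /Ss.
have subs : subspace (lspan [set` s]) := subspace_lspan _.
have [[u [Su [a [a0 ua]]]]|nS] := pselect (exists u, S u /\
   exists a, a != 0 /\ lspan [set` s] (u - a *: x)).
  have [t tS St] := IH (S `&` lspan [set` s])
     (subspaceI subS (subspace_lspan _)) (@subIsetr _ _ _).
  exists (u :: t).
    by move=> y /=; rewrite inE => /orP[/eqP ->//|/tS[]].
  move=> w Sw; have [b wb] := (lspan_cons _ _ _).1 (Ss _ Sw).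
  apply/lspan_cons; exists (b / a); apply: St; split.
    by apply: subspaceB => //; apply: subspaceZ.
  have -> : w - (b / a) *: u = (w - b *: x) - (b / a) *: (u - a *: x).
    by rewrite scalerBr scalerA mulfVK// opprB addrA subrK.
  by apply: subspaceB => //; apply: subspaceZ.
apply: IH => // w Sw; have [a wa] := (lspan_cons _ _ _).1 (Ss _ Sw).
have [a0|a0] := eqVneq a 0; first by move: wa; rewrite a0 scale0r subr0.
by exfalso; apply: nS; exists w; split => //; exists a.
Qed.

Definition indep k (f : 'I_k -> W) :=
  forall c : 'I_k -> K, \sum_i c i *: f i = 0 -> forall i, c i = 0.

Lemma lin_dep k d (a : 'I_k -> 'I_d -> K) : (d < k)%N ->
  exists2 c : 'I_k -> K, (exists i, c i != 0) & forall j, \sum_i c i * a i j = 0.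
Proof.
move=> dk; pose M := \matrix_(i, j) a i j.
have [N N0 NM] : exists2 N : 'M_k, N != 0 & N *m M = 0.
  exists (kermx M); last exact: mulmx_ker.
  rewrite kermx_eq0 /row_free; apply/negP => /eqP rM.
  by have := rank_leq_col M; rewrite rM leqNgt dk.
have [i iN] : exists i, row i N != 0.
  apply: contra_notP (negP N0) => h; apply/eqP/row_matrixP => i.
  by rewrite row0; apply/eqP; apply: contra_notT h => ?; exists i.
exists (fun j => N i j).
  apply: contra_notP (negP iN) => h; apply/eqP/rowP => j; rewrite !mxE.
  by apply/eqP; apply: contra_notT h => ?; exists j.
move=> j; have /rowP/(_ j) : row i N *m M = 0 by rewrite -row_mul NM row0.
rewrite !mxE => NME; rewrite -[RHS]NME.
by apply: eq_bigr => l _; rewrite !mxE.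
Qed.

Lemma indep_le (s : seq W) k (f : 'I_k -> W) :
  (forall i, lspan [set` s] (f i)) -> indep f -> (k <= size s)%N.
Proof.
move=> fs indf; rewrite leqNgt; apply/negP => sk.
have /choice[a fa] : forall i, exists a : 'I_(size s) -> K,
    f i = \sum_j a j *: s`_j by move=> i; apply: lspan_seqP.
have [c [i ci] cE] := lin_dep a sk.
move: ci; rewrite (indf c) ?eqxx// {i}.
under eq_bigr do rewrite fa scaler_sumr.
rewrite exchange_big big1// => j _.
by under eq_bigr do rewrite scalerA; rewrite -scaler_suml cE scale0r.
Qed.
End Subspaces.

Lemma subspace_preim (K : fieldType) (A B : lmodType K) (f : A -> B) (S : set B) :
  linear f -> subspace S -> subspace [set x | S (f x)].
Proof.
move=> linf subS.
have f0 : f 0 = 0.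
  have := linf 1 0 0; rewrite !scale1r addr0 => /eqP.
  by rewrite -subr_eq0 opprD addrA subrr sub0r oppr_eq0 => /eqP.
split=> [|a x y /= Sx Sy]; first by rewrite /= f0; apply: subspace0.
by rewrite /= linf; apply: subspaceD => //; apply: subspaceZ.
Qed.

(** The family [fun i => oapp f a (unlift ord0 i)] is f with a put in front. This lemma and
    [indep_im] are how a count of independent vectors goes up by one: here a is in the kernel of g,
    there it is the f i that are. *)
Lemma indep_ker (K : fieldType) (A B : lmodType K) (g : {linear A -> B})
    (a : A) k (f : 'I_k -> A) : a != 0 -> g a = 0 -> indep (g \o f) ->
  indep (fun i => oapp f a (unlift ord0 i)).
Proof.
move=> a0 ga indf c; rewrite big_ord_recl unlift_none /=.
under eq_bigr do rewrite liftK /=.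
move=> cE; have c0 i : c (lift ord0 i) = 0.
  apply: (indf (c \o lift ord0)) => /=.
  have := congr1 g cE; rewrite linearD linearZ /= ga scaler0 add0r linear_sum linear0.
  by move=> gE; rewrite -[RHS]gE; apply: eq_bigr => j _; rewrite /= linearZ.
move: cE; rewrite big1 => [|i _]; last by rewrite c0 scale0r.
rewrite addr0 => /eqP; rewrite scaler_eq0 (negPf a0) orbF => /eqP ca i.
by case: (unliftP ord0 i) => [j|] ->.
Qed.

Lemma indep_im (K : fieldType) (A B : lmodType K) (g : {linear A -> B})
    (a : A) k (f : 'I_k -> A) : g a != 0 -> (forall i, g (f i) = 0) -> indep f ->
  indep (fun i => oapp f a (unlift ord0 i)).
Proof.
move=> ga gf indf c; rewrite big_ord_recl unlift_none /=.
under eq_bigr do rewrite liftK /=.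
move=> cE; have ca : c ord0 = 0.
  have := congr1 g cE; rewrite linearD linearZ /= linear_sum linear0 big1 => [|i _].
    by rewrite addr0 => /eqP; rewrite scaler_eq0 (negPf ga) orbF => /eqP.
  by rewrite linearZ /= gf scaler0.
move: cE; rewrite ca scale0r add0r => /(indf (c \o lift ord0)) c0 i.
by case: (unliftP ord0 i) => [j|] ->//; apply: c0.
Qed.

Lemma indep_inj (K : fieldType) (A B : lmodType K) (g : {linear A -> B}) k
    (f : 'I_k -> A) : injective g -> indep f -> indep (g \o f).
Proof.
move=> ginj indf c cE; apply: indf; apply: ginj; rewrite linear_sum linear0 -[RHS]cE.
by apply: eq_bigr => i _; rewrite /= linearZ.
Qed.

Lemma indep_lift (K : fieldType) (A B : lmodType K) (g : {linear A -> B}) k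
    (f : 'I_k -> A) : indep (g \o f) -> indep f.
Proof.
move=> indf c cE; apply: indf; have := congr1 g cE; rewrite linear_sum linear0 => gE.
by rewrite -[RHS]gE; apply: eq_bigr => i _; rewrite /= linearZ.
Qed.

(** * Generalized eigenspaces of an endomorphism *)

Section GeneralizedEigenvectors.
Variables (K : fieldType) (W : lmodType K) (L : {linear W -> W}).

Definition shift (n : K) (x : W) := L x - n *: x.

Lemma shift_linear n : linear (shift n).
Proof.
move=> a x y; rewrite /shift linearP scalerBr scalerDr !scalerA (mulrC n).
by rewrite opprD addrACA.
Qed.
HB.instance Definition _ n := GRing.isLinear.Build K W W *:%R (shift n) (shift_linear n).

Lemma shiftC m n x : shift m (shift n x) = shift n (shift m x).
Proof.
rewrite /shift !linearB !linearZ /= !scalerN !opprK !scalerA (mulrC m).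
by rewrite -!addrA; congr (_ + _); rewrite addrCA.
Qed.

Lemma iter_shiftC k m n x : iter k (shift m) (shift n x) = shift n (iter k (shift m) x).
Proof. by elim: k => //= k ->; rewrite shiftC. Qed.

(* For m != n the differences (L - m) x_i and (L - n) x_i recover x_i; this is
   an induction on the total nilpotency exponent of the x_i. *)
Lemma geneig_components (S : set W) (r : seq K) (x : K -> W) (k : K -> nat) :
  subspace S -> (forall w, S w -> S (L w)) -> uniq r ->
  (forall i, i \in r -> iter (k i) (shift i) (x i) = 0) ->
  S (\sum_(i <- r) x i) -> forall i, i \in r -> S (x i).
Proof.
move=> subS SL ur; have [N] := ubnP (\sum_(i <- r) k i).
elim: N x k => // N IH x k; rewrite ltnS => kN xk Sx i ir.
have Sj j l : j \in r -> (0 < k j)%N -> l \in r -> S (shift j (x l)).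
  move=> jr kj; pose k' l := if l == j then (k j).-1 else k l.
  apply: (IH (fun l => shift j (x l)) k').
  - apply: leq_trans kN; rewrite (bigD1_seq j)//= [X in (_ < X)%N](bigD1_seq j)//=.
    rewrite /k' eqxx -addSn prednK// leq_add2l.
    by rewrite [X in (X <= _)%N](eq_bigr k)// => t /negPf ->.
  - move=> t tr; rewrite iter_shiftC /k'; case: eqVneq => [->|_].
      by rewrite -iterS prednK// xk.
    by rewrite xk// raddf0.
  - rewrite -raddf_sum /=; apply: subspaceB => //; first exact: SL.
    exact: subspaceZ.
have [ki|] := posnP (k i); first by have := xk i ir; rewrite ki /= => ->; apply: subspace0.
move=> ki; have [/hasP[j jr /andP[ji kj]]|/hasPn h] :=
  boolP (has (fun j => (j != i) && (0 < k j)%N) r).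
  have : S ((i - j) *: x i).
    have -> : (i - j) *: x i = shift j (x i) - shift i (x i).
      by rewrite /shift opprB [RHS]addrC addrA subrK scalerBl.
    by apply: subspaceB => //; apply: Sj.
  move=> /(subspaceZ subS (i - j)^-1); rewrite scalerA mulVf ?scale1r//.
  by rewrite subr_eq0 eq_sym.
move: Sx; rewrite (bigD1_seq i)//= big_seq_cond big1 ?addr0// => j /andP[jr ji].
have := h j jr; rewrite ji /= lt0n negbK => /eqP kj.
by have := xk j jr; rewrite kj.
Qed.

(** The eigenvector is the last nonzero iterate. It is kept in the form of an iterate so that it
    visibly stays in any L-stable subspace containing x. *)
Lemma geneig_eigenvector n k x : x != 0 -> iter k (shift n) x = 0 ->
  exists2 j, iter j (shift n) x != 0 & L (iter j (shift n) x) = n *: iter j (shift n) x.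
Proof.
elim: k x => [|k IH] x x0; first by move=> /= /eqP; rewrite (negPf x0).
rewrite iterSr => xk; have [Lx|Lx] := eqVneq (shift n x) 0.
  by exists 0%N => //=; apply/eqP; rewrite -subr_eq0; apply/eqP.
by have [j] := IH _ Lx xk; exists j.+1; rewrite iterSr.
Qed.
End GeneralizedEigenvectors.

Section Gradings.
Variables (K : fieldType) (W : lmodType K) (I : choiceType) (g : grading W I).

Lemma grading_support w : exists2 r : seq I, uniq r & forall i, g i w != 0 -> i \in r.
Proof. exact/finite_support_seq/gproj_fin. Qed.

Lemma gproj_seq w (r : seq I) : uniq r -> (forall i, g i w != 0 -> i \in r) ->
  w = \sum_(i <- r) g i w.
Proof. by move=> ur wr; rewrite {1}(gproj_sum g w); apply: fsum_seq. Qed.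

Lemma grading_ind (S : set W) w : subspace S -> (forall i, S (g i w)) -> S w.
Proof. by move=> subS Sg; rewrite (gproj_sum g w); apply: subspace_fsum. Qed.

Lemma homog_gproj i w : homog g i (g i w).
Proof. exact: gproj_idem. Qed.

Lemma gproj_homog i j w : homog g i w -> g j w = if j == i then w else 0.
Proof.
by move=> wi; case: eqVneq => [->//|ji]; rewrite -wi gproj_orth.
Qed.

Lemma gproj_eq w w' : (forall i, g i w = g i w') -> w = w'.
Proof.
by move=> ww'; rewrite (gproj_sum g w) (gproj_sum g w'); apply: eq_fsum.
Qed.

Lemma gproj_neq0 w : w != 0 -> exists i, g i w != 0.
Proof.
apply: contra_neqP => h; apply: gproj_eq => i; rewrite raddf0; apply/eqP.
by apply: contra_notT h; exists i.
Qed.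

Lemma homog_subspace i : subspace (homog g i).
Proof.
split; first by rewrite /homog /= raddf0.
by move=> a x y; rewrite /homog /= => gx gy; rewrite linearP gx gy.
Qed.

End Gradings.

Lemma fsum_linear (K : fieldType) (A B : lmodType K) (I : choiceType)
    (F : I -> A -> B) : (forall i, linear (F i)) ->
  (forall v, finite_set [set i | F i v != 0]) ->
  linear (fun v => \sum_(i \in [set: I]) F i v).
Proof.
move=> linF finF a u v.
have [r ur rP] := finite_support_seq (finF u).
have [s us sP] := finite_support_seq (finF v).
have ut : uniq (undup (r ++ s)) := undup_uniq _.
rewrite (fsum_seq ut) ?(@fsum_seq _ _ (F^~ u) _ ut) ?(@fsum_seq _ _ (F^~ v) _ ut).
- by rewrite scaler_sumr -big_split; apply: eq_bigr => i _; rewrite linF.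
- by move=> i /sP; rewrite mem_undup mem_cat orbC => ->.
- by move=> i /rP; rewrite mem_undup mem_cat => ->.
- move=> i; rewrite mem_undup mem_cat linF; apply: contraNT; rewrite negb_or.
  case/andP=> /(contraNeq (rP i)) -> /(contraNeq (sP i)) ->.
  by rewrite scaler0 addr0.
Qed.

(** * Weights and zero modes *)

Section Binomials.
Variable R : realType.
Local Notation C := R[i].

Lemma binz0 (n : int) : binz R n 0 = 1.
Proof. by rewrite /binz big_ord0 fact0 divr1. Qed.

Lemma binz1 (n : int) : binz R n 1 = n%:~R.
Proof. by rewrite /binz big_ord1 subr0 factS fact0 muln1 divr1. Qed.

Lemma binz_nat_eq0 (n i : nat) : (n < i)%N -> binz R n i = 0.
Proof.
move=> ni; rewrite /binz (bigD1 (Ordinal ni)) //= -pmulrn subrr.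
by rewrite !mul0r.
Qed.

Lemma subexp_n0 (n : int) : subexp R n 0 = 1.
Proof. by rewrite /subexp binz0 mul1r. Qed.

Lemma subexp_0n i : (0 < i)%N -> subexp R 0 i = 0.
Proof. by move=> i0; rewrite /subexp (binz_nat_eq0 i0) mulr0. Qed.

(** Upper negation of binomials. It shows that the iterate side of the Jacobi identity is a single
    term when m = 0 and is finite when m is natural. *)
Lemma subexp_neg (m : int) i : subexp R (i%:Z - m - 1) i = binz R m i.
Proof.
rewrite /subexp /binz mulrA; congr (_ / _).
rewrite -[X in (-1) ^+ X]card_ord -prodrN (reindex_inj rev_ord_inj) /=.
apply: eq_bigr => j _; rewrite natrB ?ltn_ord// !rmorphB /= -natr1 -pmulrn.
by ring.
Qed.
End Binomials.

Lemma subz0 (n : int) : n - 0%:Z = n. Proof. exact: subr0. Qed.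

Section RealPart.
Variable R : realType.
Implicit Types x y : R[i].

Lemma ReD x y : complex.Re (x + y) = complex.Re x + complex.Re y.
Proof. by case: x y => [? ?] [? ?]. Qed.

Lemma ReB x y : complex.Re (x - y) = complex.Re x - complex.Re y.
Proof. by case: x y => [? ?] [? ?]. Qed.

Lemma Re_nat n : complex.Re (n%:R : R[i]) = n%:R.
Proof. by elim: n => // n IH; rewrite -!natr1 ReD IH. Qed.

Lemma Re_int (n : int) : complex.Re (n%:~R : R[i]) = n%:~R.
Proof.
by case: n => n; rewrite ?NegzE ?rmorphN -?pmulrn ?Re_nat// -sub0r ReB Re_nat sub0r.
Qed.

Lemma nat_gt (x : R) : exists n : nat, x < n%:R.
Proof.
by exists (Num.bound `|x|); rewrite (le_lt_trans (ler_norm x))// archi_boundP.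
Qed.
End RealPart.

Section VertexAction.
Variables (R : realType) (V W : lmodType R[i]) (YV : vertex_map V V).
Variables (vac omega : V) (c : R[i]) (YW : vertex_map V W).
Hypothesis va : vertex_action YV vac omega c YW.

Lemma va_support u w (f : nat -> int) (F : nat -> R[i]) :
  (forall N : int, exists M, forall i, (M <= i)%N -> N <= f i) ->
  finite_set [set i | F i *: YW (f i) u w != 0].
Proof.
move=> fP; have [N NP] := va_truncation va u w; have [M MP] := fP N.
by apply: (@finite_support_nat _ _ M) => i /MP /NP ->; rewrite scaler0.
Qed.

(** The Jacobi identity at l = 0, where each sum on the left has only its term i = 0. *)
Lemma va_commutator u v w m n :
  YW m u (YW n v w) - YW n v (YW m u w) =
  \sum_(i \in [set: nat]) binz R m i *: YW (m + n - i%:Z) (YV i%:Z u v) w.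
Proof.
have := va_jacobi va u v w 0 m n.
rewrite [X in X - _](fsum1 (i0 := 0%N)) => [|i i0]; last first.
  by rewrite subexp_0n ?lt0n// scale0r.
rewrite [X in _ - X](fsum1 (i0 := 0%N)) => [|i i0]; last first.
  by rewrite subexp_0n ?lt0n// mulr0 scale0r.
rewrite expr0z mul1r !subexp_n0 !scale1r !add0r !subz0 => ->.
by apply: eq_fsum => i; rewrite subexp_neg add0r.
Qed.

Lemma va_Lm1 n u w :
  YW n (YV 0 omega u) w = (- n)%:~R *: YW (n - 1) u w.
Proof. by have := va_derivative va n u w; rewrite /vir addNr. Qed.

Lemma va_commLm1 n u w :
  YW 0 omega (YW n u w) - YW n u (YW 0 omega w) = (- n)%:~R *: YW (n - 1) u w.
Proof.
rewrite va_commutator (fsum1 (i0 := 0%N)) => [|i i0]; last first.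
  by rewrite (@binz_nat_eq0 R 0) ?lt0n// scale0r.
by rewrite binz0 scale1r add0r subz0 va_Lm1.
Qed.

(** In the commutator with omega_1 = L(0) only i = 0 and i = 1 survive; they carry L(-1)u, a
    derivative, and L(0)u = hu. *)
Lemma va_commL0 n u w (h : R[i]) : YV 1 omega u = h *: u ->
  YW 1 omega (YW n u w) - YW n u (YW 1 omega w) = (h - (n + 1)%:~R) *: YW n u w.
Proof.
move=> hu; rewrite va_commutator (@fsum_nat _ _ 2) => [|i i2]; last first.
  by rewrite (@binz_nat_eq0 R 1) ?scale0r.
rewrite big_ord_recr big_ord1 /= binz0 binz1 subz0 va_Lm1 hu !scale1r.
rewrite (_ : 1 + n - 1 = n); last by lia.
by rewrite linearZl_LR /= scalerBl addrC (addrC 1) rmorphN scaleNr.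
Qed.
End VertexAction.

Section Weights.
Variables (R : realType) (V : voa R).
Local Notation C := R[i].
Local Notation YV := (voa_Y V).
Local Notation omega := (voa_omega V).
Implicit Type W : genmod V.

Definition L0 W : {linear W -> W} := gm_Y W 1 omega.

Lemma homogP W n w :
  homog (gm_gr W) n w <-> exists k, iter k (shift (L0 W) n) w = 0.
Proof.
exact: gm_geneig.
Qed.

Lemma homog_eigen W n w : L0 W w = n *: w -> homog (gm_gr W) n w.
Proof. by move=> wn; apply/homogP; exists 1%N; rewrite /= /shift wn subrr. Qed.

Lemma voa_homogL0 h u : homog (voa_gr V) h u -> YV 1 omega u = h%:~R *: u.
Proof. by move=> /voa_L0; rewrite /vir add0r. Qed.

(** That modes shift weights is not an axiom of [voa]; it is derived by computing L(0), so a
    converse to [voa_L0] is needed. It holds because the components of u have distinct integer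
    eigenvalues. *)
Lemma voa_homogP h u : YV 1 omega u = h%:~R *: u -> homog (voa_gr V) h u.
Proof.
move=> uh; suff g0 j : j != h -> voa_gr V j u = 0.
  by rewrite /homog /= [in RHS](gproj_sum (voa_gr V) u) (fsum1 g0).
move=> jh; have [r ur rP] := grading_support (voa_gr V) u.
have : voa_gr V j (YV 1 omega u) = j%:~R *: voa_gr V j u.
  rewrite [in LHS](gproj_seq ur rP) [in RHS](gproj_seq ur rP) !linear_sum.
  apply: eq_bigr => i _ /=; rewrite (voa_homogL0 (homog_gproj _ i u)) linearZ /=.
  rewrite !(gproj_homog _ (homog_gproj (voa_gr V) i u)).
  by case: eqVneq => [->|]; rewrite ?scaler0.
move/eqP; rewrite uh linearZ /= -subr_eq0 -scalerBl scaler_eq0 -rmorphB intr_eq0.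
by rewrite subr_eq0 eq_sym (negPf jh) /= => /eqP.
Qed.

Lemma voa_homog_op a b k u v : homog (voa_gr V) a u -> homog (voa_gr V) b v ->
  homog (voa_gr V) (a + b - k - 1) (YV k u v).
Proof.
move=> ua vb; apply: voa_homogP.
have /eqP := va_commL0 (voa_action V) k v (voa_homogL0 ua).
rewrite (voa_homogL0 vb) linearZ /= subr_eq -scalerDl => /eqP ->.
by congr (_ *: _); rewrite -!rmorphB -rmorphD; congr _%:~R; lia.
Qed.

(** L(0) - (n + h - k - 1) applied after u_k is u_k applied after L(0) - n, so the nilpotency
    exponent of w serves for u_k w too. *)
Lemma homog_op W (n : C) (h k : int) u w : homog (voa_gr V) h u ->
  homog (gm_gr W) n w -> homog (gm_gr W) (n + (h - k - 1)%:~R) (gm_Y W k u w).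
Proof.
move=> /voa_homogL0 uh /homogP[j wj]; apply/homogP; exists j.
suff E x : shift (L0 W) (n + (h - k - 1)%:~R) (gm_Y W k u x) =
    gm_Y W k u (shift (L0 W) n x).
  suff -> : iter j (shift (L0 W) (n + (h - k - 1)%:~R)) (gm_Y W k u w) =
     gm_Y W k u (iter j (shift (L0 W) n) w) by rewrite wj linear0.
  by elim: j {wj} => //= j ->.
rewrite /shift /= linearBr linearZr_LR scalerDl opprD.
have /eqP := va_commL0 (gm_action W) k x uh.
rewrite subr_eq => /eqP ->.
rewrite -rmorphB /= (_ : h - (k + 1) = h - k - 1); last by lia.
by rewrite [X in X + _]addrC addrACA subrr addr0.
Qed.

Variable W : genmod V.

Lemma submodule_subspace (S : set W) : submodule S -> subspace S.
Proof. by case. Qed.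

Lemma submodule_gproj (S : set W) x n : submodule S -> S x -> S (gm_gr W n x).
Proof.
move=> subS Sx; have [r ur rP] := grading_support (gm_gr W) x.
have [nr|/(contraNeq (rP n)) ->] := boolP (n \in r); last by case: subS.
have /choice[k kP] : forall i : C, exists k, iter k (shift (L0 W) i) (gm_gr W i x) = 0.
  by move=> i; apply/homogP/homog_gproj.
apply: (geneig_components (L := L0 W) (x := fun i => gm_gr W i x) (k := k)
  (submodule_subspace subS)) nr => //.
- by move=> w Sw; case: subS => _ _; apply.
- by rewrite -gproj_seq.
Qed.

(* u_k lowers the weight exactly when wt u <= k. *)
Definition lowest_vector (n : C) (w : W) :=
  L0 W w = n *: w /\ forall u (h k : int), homog (voa_gr V) h u -> h <= k -> gm_Y W k u w = 0.

(** Zhu's o(u)w: for homogeneous u the mode of index wt u - 1, which preserves weights, extended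
    linearly to all u. *)
Definition zero_mode (w : W) (u : V) : W :=
  \sum_(h \in [set: int]) gm_Y W (h - 1) (voa_gr V h u) w.

Lemma zero_mode_linear w : linear (zero_mode w).
Proof.
apply: (@fsum_linear _ _ _ _ (fun h u => gm_Y W (h - 1) (voa_gr V h u) w)).
  by move=> h a u v; rewrite linearP linearPl.
move=> u; apply: sub_finite_set (gproj_fin (voa_gr V) u) => h /=.
by apply: contra_neq => ->; rewrite linear0l.
Qed.
HB.instance Definition _ w :=
  GRing.isLinear.Build C V W *:%R (zero_mode w) (zero_mode_linear w).

Lemma zero_mode_homog w h u : homog (voa_gr V) h u ->
  zero_mode w u = gm_Y W (h - 1) u w.
Proof.
move=> uh; rewrite /zero_mode (fsum1 (i0 := h)) ?uh// => j jh.
by rewrite (gproj_homog _ uh) (negPf jh) linear0l.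
Qed.

(** The Jacobi identity at l = -2N - 2, m = a + N, n = b + N. On the left each term begins with a
    mode of v of index at least b or of u of index at least a, and these kill w; the right side is
    the zero mode of the residue defining O_N. *)
Lemma zero_mode_zhu N n w u v a b : lowest_vector n w ->
  homog (voa_gr V) a u -> homog (voa_gr V) b v ->
  zero_mode w (\sum_(j \in [set: nat])
    binz R (a + N%:Z) j *: voa_Y V (- (2 * N + 2)%N%:Z + j%:Z) u v) = 0.
Proof.
move=> [_ w0] ua vb; rewrite fsum_morph; last first.
  apply: (va_support (voa_action V)) => M.
  by exists (`|M| + (2 * N + 2))%N => i; lia.
pose l : int := - (2 * N + 2)%N%:Z.
have := va_jacobi (gm_action W) u v w l (a + N%:Z) (b + N%:Z).
rewrite fsum0 => [|i]; last by rewrite (w0 v b) ?linear0r ?scaler0//; lia.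
rewrite fsum0 => [|i]; last by rewrite (w0 u a) ?linear0r ?scaler0//; lia.
rewrite subr0 => E; rewrite [RHS]E; apply: eq_fsum => i.
rewrite /= linearZ /= (zero_mode_homog _ (voa_homog_op _ ua vb)) subexp_neg.
by congr (_ *: gm_Y W _ _ _); rewrite /l; lia.
Qed.

Lemma zero_mode_On N n w : lowest_vector n w -> @On R V N `<=` [set u | zero_mode w u = 0].
Proof.
move=> wn; have sub0 : subspace [set u | zero_mode w u = 0].
  split=> [|a x y /= x0 y0]; first exact: linear0.
  by rewrite linearP /= x0 y0 scaler0 addr0.
apply: (lspan_min sub0) => _ [[u [v ->]]|[u ->]].
  rewrite /zhu_res; apply: (subspace_fsum sub0) => a.
  set ua := voa_gr V a u. have ha : homog (voa_gr V) a ua by exact: homog_gproj.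
  pose F v := \sum_(j \in [set: nat])
    binz R (a + N%:Z) j *: voa_Y V (- (2 * N + 2)%N%:Z + j%:Z) ua v.
  have linF : linear F.
    apply: (@fsum_linear _ _ _ _ (fun (j : nat) v =>
      binz R (a + N%:Z) j *: voa_Y V (- (2 * N + 2)%N%:Z + j%:Z) ua v)).
      by move=> j c x y; rewrite linearP scalerDr !scalerA mulrC.
    move=> x; apply: (va_support (voa_action V)) => M.
    by exists (`|M| + (2 * N + 2))%N => i; lia.
  apply: (grading_ind (g := voa_gr V) (S := [set v | zero_mode w (F v) = 0])) => [|b].
    split=> [|c x y /= x0 y0].
      rewrite /= (_ : F 0 = 0) ?linear0// -[RHS](subrr (F 0)).
      by rewrite -[X in F X - _](addr0 0) -[X in F (X + _)](scale1r 0) linF scale1r addrK.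
    by rewrite /= linF linearP /= x0 y0 scaler0 addr0.
  exact: zero_mode_zhu wn ha (homog_gproj _ _ _).
apply: (grading_ind (g := voa_gr V) (S := [set u | zero_mode w
    (vir omega YV (-1) u + vir omega YV 0 u) = 0])) => [|h].
  split=> [|c x y /= x0 y0]; first by rewrite /= /vir !linear0r addr0 linear0.
  by rewrite /= /vir !linearPr addrACA -scalerDr linearP /= x0 y0 scaler0 addr0.
(* L(-1)x has weight h + 1, and its zero mode (L(-1)x)_h is -h x_(h-1), which cancels that of L(0)x
   = hx. *)
set x := voa_gr V h u; have hx : homog (voa_gr V) h x := homog_gproj _ _ _.
rewrite /= /vir addNr add0r linearD /= (voa_homogL0 hx) linearZ /=.
rewrite (zero_mode_homog _ hx).
rewrite (zero_mode_homog _ (voa_homog_op 0 (voa_omega2 V) hx)).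
rewrite (_ : 2 + h - 0 - 1 - 1 = h); last by lia.
by rewrite (va_Lm1 (gm_action W)) rmorphN scaleNr addNr.
Qed.

Fixpoint vir_power (j : nat) : V :=
  if j is i.+1 then YV (-1) omega (vir_power i) else voa_vac V.

Lemma vir_power_homog j : homog (voa_gr V) (2 * j)%N%:Z (vir_power j).
Proof.
elim: j => [|j IH] /=; first exact: voa_vac0.
rewrite (_ : (2 * j.+1)%N%:Z = 2 + (2 * j)%N%:Z - (-1) - 1); last by lia.
exact: voa_homog_op (voa_omega2 V) IH.
Qed.

(** For u of weight h one has o(L(-2)u)w = (n + h) o(u)w; the product arises from the weights h = 0,
    2, 4, ... of the successive powers. *)
Lemma zero_mode_vir_power n w j : lowest_vector n w ->
  zero_mode w (vir_power j) = (\prod_(i < j) (n + (2 * i)%N%:R)) *: w.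
Proof.
move=> [wn w0]; elim: j => [|j IH].
  rewrite big_ord0 scale1r (zero_mode_homog _ (vir_power_homog 0)) /=.
  by rewrite (va_vacuum (gm_action W)).
rewrite big_ord_recr /= mulrC -scalerA -IH.
rewrite (zero_mode_homog _ (vir_power_homog j.+1)) (zero_mode_homog _ (vir_power_homog j)).
have -> : (2 * j.+1)%N%:Z - 1 = (2 * j)%N%:Z + 1 by lia.
have := vir_power_homog j; rewrite (pmulrn 1 (2 * j)) /=; move: (vir_power j) (Posz (2 * j)) => u h hu.
(* On the lowest vector w this instance reduces to (L(-2)u)_(h+1) w = u_h L(-1)w + u_(h-1) L(0)w.
   The first term is h u_(h-1) w, by the commutator with L(-1) and u_h w = 0. *)
have := va_jacobi (gm_action W) omega u w (-1) 0 (h + 1).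
rewrite fsum0 => [|i]; last by rewrite (w0 u h) ?linear0r ?scaler0//; lia.
rewrite (@fsum_nat _ _ 2) => [|i i2]; last first.
  by rewrite (w0 _ _ _ (voa_omega2 V)) ?linear0r ?scaler0//; lia.
rewrite big_ord_recr big_ord1 /= subexp_n0.
rewrite (fsum1 (i0 := 0%N)) => [|i i0]; last first.
  by rewrite subexp_neg (@binz_nat_eq0 R 0) ?lt0n// scale0r.
have -> : subexp R (-1) 1 = 1 by rewrite /subexp binz1 expr1 mulN1r rmorphN opprK.
rewrite subexp_n0 (_ : (-1) ^ (-1) = -1 :> R[i]); last by rewrite exprN1 invrN1.
have -> : -1 + (h + 1) - 0%Z = h by lia.
have -> : -1 + (h + 1) - 1%Z = h - 1 by lia.
have -> : 0 + (h + 1) - 0%Z = h + 1 by lia.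
have -> : 0 + 0%Z = 0 :> int by [].
have -> : 0 + 1%Z = 1 :> int by [].
have -> : -1 + 0%Z = -1 :> int by [].
rewrite mulr1 scale1r !scaleN1r -opprD sub0r opprK => <-.
have /eqP := va_commLm1 (gm_action W) h u w; rewrite (w0 u h)// linear0r sub0r.
rewrite rmorphN scaleNr eqr_opp => /eqP ->.
have -> : gm_Y W 1 omega w = n *: w := wn.
by rewrite linearZr_LR /= -scalerDl addrC.
Qed.

Hypothesis W_lower : lower_truncated W.

(** Descend from m by integer steps inside S as far as possible, which lower truncation bounds, and
    replace the vector found by an eigenvector of the same weight. A lowering mode that did not kill
    it would lead further down within S. *)
Lemma lowest_vector_exists (S : set W) m x : submodule S -> x != 0 -> S x ->
  homog (gm_gr W) m x ->
  exists k : nat, exists y, [/\ S y, y != 0, homog (gm_gr W) (m - k%:R) y &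
    lowest_vector (m - k%:R) y].
Proof.
move=> subS x0 Sx xm; have [r rP] := W_lower.
pose A k := `[< exists y, [/\ S y, y != 0 & homog (gm_gr W) (m - k%:R) y] >].
have exA : exists k, A k by exists 0%N; apply/asboolP; exists x; rewrite subr0.
have [M MP] := nat_gt (complex.Re m - r).
have leM k : A k -> (k <= M)%N.
  move=> /asboolP[y [Sy y0 yh]]; rewrite leqNgt; apply: contra_neqN y0 => Mk.
  rewrite -yh rP// ReB Re_nat ltrBlDr addrC -ltrBlDr (lt_le_trans MP)//.
  by rewrite ler_nat ltnW.
case: (ex_maxnP exA leM) => k /asboolP[y [Sy y0 yh]] kmax; exists k.
have [j yj] := (homogP _ _).1 yh.
have [l] := geneig_eigenvector y0 yj; set t := iter l _ y => t0 Lt.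
have St : S t.
  rewrite /t; elim: l {t t0 Lt} => //= l Sl; have subS' := submodule_subspace subS.
  apply: subspaceB => //; last exact: subspaceZ.
  by case: subS => _ _; apply.
exists t; split => //; first exact: homog_eigen.
split=> // u h q uh hl; apply/eqP; apply: contraT => ut.
(* The mode u_q lowers the weight by q + 1 - h, which is at least 1 since h <= q. *)
suff /kmax : A (k + `|(q + 1 - h)%R|)%N by lia.
apply/asboolP; exists (gm_Y W q u t); split=> //; first by case: subS => _ _; apply.
have -> : m - (k + `|(q + 1 - h)%R|)%N%:R = m - k%:R + (h - q - 1)%:~R.
  rewrite natrD opprD addrA; congr (_ + _).
  by rewrite natr_absz ger0_norm -?rmorphN /=; [congr _%:~R; lia|lia].
exact: homog_op uh (homog_eigen Lt).
Qed.
End Weights.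

(** * Finiteness of the set of lowest weights *)

Lemma poly_indep (F : fieldType) (q : nat -> {poly F}) k (c : 'I_k -> F) :
  (forall j, size (q j) = j.+1) -> \sum_(j < k) c j *: q j = 0 -> forall j, c j = 0.
Proof.
move=> sq; elim: k c => [|k IH] c; first by move=> _ [].
rewrite big_ord_recr /= => cE.
have ck : c ord_max = 0.
  have := congr1 (fun p : {poly F} => p`_k) cE; rewrite coefD coefZ coef0 coef_sum big1.
    rewrite add0r => /eqP; rewrite mulf_eq0 => /orP[/eqP//|].
    by rewrite -[X in _`_X]/(k.+1.-1) -(sq k) -/(lead_coef _) lead_coef_eq0 -size_poly_eq0 sq.
  by move=> j _; rewrite coefZ nth_default ?mulr0// sq ltn_ord.
move: cE; rewrite ck scale0r addr0 => /(IH (fun j => c (widen_ord (leqnSn k) j))) c0 j.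
case: (unliftP ord_max j) => [i|] ->//.
by rewrite -[RHS](c0 i); congr c; apply: val_inj; rewrite /= /bump leqNgt ltn_ord.
Qed.

Section LowestWeights.
Variables (R : realType) (V : voa R).
Local Notation C := R[i].

(** If d vectors span V modulo O_N, the d + 1 elements L(-2)^j 1 satisfy a relation modulo O_N. Its
    coefficients c involve V and N only, so the resulting combination of the polynomials [q j]
    serves every W and w; it is nonzero because [q j] has degree j. *)
Lemma lowest_weight_poly N : An_fin_dim V N ->
  exists2 p : {poly C}, p != 0 & forall (W : genmod V) n (w : W), w != 0 ->
    lowest_vector n w -> root p n.
Proof.
move=> [s sP]; pose d := size s.
have /choice[a aP] : forall j : 'I_d.+1, exists a : 'I_d -> C,
    On N (vir_power V j - \sum_i a i *: s`_i).
  move=> j; have [u uO /lspan_seqP[a aE]] := sP (vir_power V j).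
  by exists a; rewrite -aE subKr.
have [c [j cj] ca] := lin_dep a (ltnSn d).
pose q j : {poly C} := \prod_(i < j) ('X + (2 * i)%N%:R%:P).
have sq i : size (q i) = i.+1.
  rewrite /q (eq_bigr (fun i : 'I_i => 'X - (- (2 * i)%N%:R)%:P)) => [|l _].
    by rewrite size_prod_XsubC /index_enum -enumT size_enum_ord.
  by rewrite polyCN opprK.
exists (\sum_(i < d.+1) c i *: q i).
  by apply: contra_neq cj => /(poly_indep sq).
move=> W n w w0 wn; rewrite /root.
have : zero_mode w (\sum_(i < d.+1) c i *: vir_power V i) = 0.
  apply: (zero_mode_On (N := N) wn).
  have -> : \sum_(i < d.+1) c i *: vir_power V i =
      \sum_(i < d.+1) c i *: (vir_power V i - \sum_l a i l *: s`_l).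
    under [RHS]eq_bigr do rewrite scalerBr.
    rewrite sumrB [X in _ - X](_ : _ = 0) ?subr0//.
    under eq_bigr do rewrite scaler_sumr.
    rewrite exchange_big big1// => l _; under eq_bigr do rewrite scalerA.
    by rewrite -scaler_suml ca scale0r.
  have subO : subspace (@On R V N) := subspace_lspan _.
  by apply: subspace_sum => // i _; apply: subspaceZ.
rewrite linear_sum (eq_bigr (fun i => (c i * (q i).[n]) *: w)) => [|i _]; last first.
  rewrite linearZ /= (zero_mode_vir_power _ wn) scalerA; congr (_ * _ *: _).
  by rewrite /q horner_prod; apply: eq_bigr => l _; rewrite hornerD hornerX hornerC.
rewrite -scaler_suml => /eqP; rewrite scaler_eq0 (negPf w0) orbF horner_sum.
by under eq_bigr do rewrite -hornerZ.
Qed.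

(** The form covers two uses: every weight of W lies in P plus a natural number, which bounds the
    weights below, and every nonzero submodule S meets the degrees in P. *)
Lemma lowest_weights_finite N : An_fin_dim V N ->
  exists P : seq C, forall (W : genmod V) (S : set W) m x,
    lower_truncated W -> submodule S -> x != 0 -> S x -> homog (gm_gr W) m x ->
    exists k : nat, m - k%:R \in P /\
      exists y, [/\ S y, y != 0 & homog (gm_gr W) (m - k%:R) y].
Proof.
move=> /lowest_weight_poly[p p0 pP].
have [P pE] := closed_field_poly_normal p.
exists P => W S m x Wl subS x0 Sx xm.
have [k [y [Sy y0 yh yl]]] := lowest_vector_exists Wl subS x0 Sx xm.
exists k; split; last by exists y.
have := pP _ _ _ y0 yl; rewrite pE rootZ ?lead_coef_eq0//.
by rewrite root_prod_XsubC.
Qed.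
End LowestWeights.

(** * Submodules, quotients and direct sums *)

Section Bundling.
Variables (K : fieldType) (U U' W : lmodType K).

Definition mk_linear (f : U -> W) (h : linear f) : {linear U -> W} :=
  HB.pack_for {linear U -> W} f (GRing.isLinear.Build K U W *:%R f h).

Definition mk_bilinear (f : U -> U' -> W) (h : bilinear_for *:%R *:%R f) :
  {bilinear U -> U' -> W} :=
  HB.pack_for {bilinear U -> U' -> W} f
    (bilinear_isBilinear.Build K U U' W *:%R *:%R f h).
End Bundling.

Section SubspaceType.
Variables (K : fieldType) (W : lmodType K).

Record subspace_of := Subspace { sub_set : set W; sub_setP : subspace sub_set }.
Variable S : subspace_of.

Definition sub_pred : {pred W} := fun x => `[< sub_set S x >].

Lemma sub_pred_closed : submod_closed sub_pred.
Proof.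
split; first by apply/asboolP; case: (sub_setP S).
by move=> a x y /asboolP Sx /asboolP Sy; apply/asboolP; case: (sub_setP S) => _; apply.
Qed.
HB.instance Definition _ := GRing.isSubmodClosed.Build K W sub_pred sub_pred_closed.

Definition sub_type := {x : W | x \in sub_pred}.
HB.instance Definition _ := SubChoice.on sub_type.
HB.instance Definition _ := [SubChoice_isSubLmodule of sub_type by <:].

Lemma sub_typeP (x : sub_type) : sub_set S (val x).
Proof. by apply/asboolP; have := valP x. Qed.

Definition mk_sub x (Sx : sub_set S x) : sub_type := exist _ x (asboolT Sx).

Definition sub_closed : zmodClosed W := sub_pred.
Definition quot_type := Quotient.quot sub_closed.
HB.instance Definition _ := GRing.Zmodule.on quot_type.
Local Open Scope quotient_scope.

Lemma quot_eq x y : (\pi_quot_type x = \pi_quot_type y) <-> sub_set S (x - y).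
Proof.
split=> [/eqP|Sxy].
  by rewrite -Quotient.idealrBE => /asboolP.
by apply/eqP; rewrite -Quotient.idealrBE; apply/asboolP.
Qed.

Lemma quot_piD x y : \pi_quot_type (x + y) = \pi_quot_type x + \pi_quot_type y.
Proof. by rewrite !piE. Qed.

Definition quot_scale (a : K) (q : quot_type) : quot_type := \pi_quot_type (a *: repr q).

Lemma quot_scale_pi a x : quot_scale a (\pi_quot_type x) = \pi_quot_type (a *: x).
Proof.
apply/quot_eq; rewrite -scalerBr; apply: subspaceZ; first exact: sub_setP.
by apply/quot_eq; rewrite reprK.
Qed.

Lemma quot_typeP q : exists x, q = \pi_quot_type x.
Proof. by exists (repr q); rewrite reprK. Qed.

Lemma quot_scalerA a b q : quot_scale a (quot_scale b q) = quot_scale (a * b) q.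
Proof.
have [x ->] := quot_typeP q.
by rewrite (quot_scale_pi b x) (quot_scale_pi a (b *: x)) (quot_scale_pi _ x) scalerA.
Qed.
Lemma quot_scale1r : left_id 1 quot_scale.
Proof. by move=> q; have [x ->] := quot_typeP q; rewrite (quot_scale_pi 1 x) scale1r. Qed.
Lemma quot_scalerDr : right_distributive quot_scale +%R.
Proof.
move=> a p q; have [x ->] := quot_typeP p; have [y ->] := quot_typeP q.
rewrite -quot_piD (quot_scale_pi a (x + y)) (quot_scale_pi a x) (quot_scale_pi a y).
by rewrite scalerDr quot_piD.
Qed.
Lemma quot_scalerDl q : {morph quot_scale^~ q : a b / a + b}.
Proof.
move=> a b; have [x ->] := quot_typeP q.
rewrite (quot_scale_pi _ x) (quot_scale_pi a x) (quot_scale_pi b x).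
by rewrite scalerDl quot_piD.
Qed.
HB.instance Definition _ := GRing.Zmodule_isLmodule.Build K quot_type
  quot_scalerA quot_scale1r quot_scalerDr quot_scalerDl.

Lemma quot_pi_linear : linear (\pi_quot_type : W -> quot_type).
Proof. by move=> a x y; rewrite quot_piD -(quot_scale_pi a x). Qed.
Definition quot_pi : {linear W -> quot_type} := mk_linear quot_pi_linear.

Lemma quot_pi_surj q : exists x, quot_pi x = q.
Proof. by exists (repr q); rewrite /= reprK. Qed.

Lemma quot_pi_eq0 x : quot_pi x = 0 <-> sub_set S x.
Proof.
have -> : 0 = quot_pi 0 by rewrite linear0.
by have := quot_eq x 0; rewrite subr0.
Qed.
End SubspaceType.

(** * Transport of the module axioms along linear maps *)

Section JacobiDefect.
Variables (R : realType) (V : voa R).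
Local Notation C := R[i].

Definition truncated (W : lmodType C) (Y : vertex_map V W) :=
  forall u w, exists N : int, forall n, N <= n -> Y n u w = 0.

(** With everything on one side, the axiom becomes the vanishing of a vector compatible with linear
    maps that commute with the modes. It can then be pulled back along injective maps and pushed
    forward along surjective ones. *)
Definition jacobi_defect (W : lmodType C) (Y : vertex_map V W) u v w (l m n : int) :=
  \sum_(i \in [set: nat]) subexp R l i *: Y (l + m - i%:Z) u (Y (n + i%:Z) v w)
  - \sum_(i \in [set: nat])
        ((-1) ^ l * subexp R l i) *: Y (l + n - i%:Z) v (Y (m + i%:Z) u w)
  - \sum_(i \in [set: nat])
        subexp R (i%:Z - m - 1) i *: Y (m + n - i%:Z) (voa_Y V (l + i%:Z) u v) w.

Lemma jacobiP (W : lmodType C) (Y : vertex_map V W) :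
  jacobi (voa_Y V) Y <-> forall u v w l m n, jacobi_defect Y u v w l m n = 0.
Proof.
split=> h u v w l m n; first by rewrite /jacobi_defect h subrr.
by apply/eqP; rewrite -subr_eq0; apply/eqP/h.
Qed.

Variables (A B : lmodType C) (YA : vertex_map V A) (YB : vertex_map V B).
Variable g : {linear A -> B}.
Hypothesis gY : forall k u x, g (YA k u x) = YB k u (g x).
Hypothesis truncA : truncated YA.

Lemma jacobi_defect_morph u v w l m n :
  g (jacobi_defect YA u v w l m n) = jacobi_defect YB u v (g w) l m n.
Proof.
have [Nu Pu] := truncA u w; have [Nv Pv] := truncA v w.
have [Nw Pw] := va_truncation (voa_action V) u v.
have trunc (p q : int) : exists M, forall i, (M <= i)%N -> p <= q + i%:Z.
  by exists `|p - q|%N => i; lia.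
have [Mu Qu] := trunc Nu m; have [Mv Qv] := trunc Nv n; have [Mw Qw] := trunc Nw l.
rewrite /jacobi_defect !raddfB /=; congr (_ - _ - _).
- rewrite fsum_morph /=; last first.
    by apply: (@finite_support_nat _ _ Mv) => i /Qv/Pv ->; rewrite linear0r scaler0.
  by apply: eq_fsum => i; rewrite linearZ /= !gY.
- rewrite fsum_morph /=; last first.
    by apply: (@finite_support_nat _ _ Mu) => i /Qu/Pu ->; rewrite linear0r scaler0.
  by apply: eq_fsum => i; rewrite linearZ /= !gY.
- rewrite fsum_morph /=; last first.
    by apply: (@finite_support_nat _ _ Mw) => i /Qw/Pw ->; rewrite linear0l scaler0.
  by apply: eq_fsum => i; rewrite linearZ /= !gY.
Qed.

Lemma vir_morph m x : g (vir (voa_omega V) YA m x) = vir (voa_omega V) YB m (g x).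
Proof. exact: gY. Qed.

Definition virasoro_defect (W : lmodType C) (Y : vertex_map V W) (m n : int) (w : W) :=
  let L := vir (voa_omega V) Y in
  L m (L n w) - L n (L m w) - ((m - n)%:~R *: L (m + n) w
    + (if m + n == 0 then ((m ^+ 3 - m)%:~R / 12%:R * voa_charge V) *: w else 0)).

Lemma virasoro_defect_morph m n w :
  g (virasoro_defect YA m n w) = virasoro_defect YB m n (g w).
Proof.
rewrite /virasoro_defect !raddfB raddfD /= !vir_morph linearZ /= vir_morph.
by congr (_ - (_ + _)); case: ifP => _; rewrite ?linear0// linearZ.
Qed.
End JacobiDefect.

Lemma virasoroP (R : realType) (V : voa R) (W : lmodType R[i]) (Y : vertex_map V W) :
  virasoro (voa_omega V) (voa_charge V) Y <->
  forall m n w, virasoro_defect Y m n w = 0.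
Proof.
split=> h; first by move=> m n w; rewrite /virasoro_defect h subrr.
move=> m n w.
by apply/eqP; rewrite -subr_eq0; apply/eqP/h.
Qed.

(** * Structures detected by two maps with trivial common kernel: submodules (the inclusion twice)
    and direct sums (the two projections) *)

Section JointlyInjective.
Variables (R : realType) (V : voa R).
Local Notation C := R[i].
Variables (Q : lmodType C) (YQ : vertex_map V Q) (prQ : C -> {linear Q -> Q}).
Variables (W1 W2 : genmod V) (g1 : {linear Q -> W1}) (g2 : {linear Q -> W2}).
Hypothesis g1Y : forall k u x, g1 (YQ k u x) = gm_Y W1 k u (g1 x).
Hypothesis g2Y : forall k u x, g2 (YQ k u x) = gm_Y W2 k u (g2 x).
Hypothesis g1pr : forall n x, g1 (prQ n x) = gm_gr W1 n (g1 x).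
Hypothesis g2pr : forall n x, g2 (prQ n x) = gm_gr W2 n (g2 x).
Hypothesis ginj : forall x, g1 x = 0 -> g2 x = 0 -> x = 0.

Lemma joint_eq x y : g1 x = g1 y -> g2 x = g2 y -> x = y.
Proof.
move=> e1 e2; apply/eqP; rewrite -subr_eq0; apply/eqP.
by apply: ginj; rewrite linearB ?e1 ?e2 subrr.
Qed.

Lemma joint_action :
  vertex_action (voa_Y V) (voa_vac V) (voa_omega V) (voa_charge V) YQ.
Proof.
have trunc : truncated YQ.
  move=> u w; have [N1 P1] := va_truncation (gm_action W1) u (g1 w).
  have [N2 P2] := va_truncation (gm_action W2) u (g2 w).
  exists (Num.max N1 N2) => n; rewrite ge_max => /andP[n1 n2].
  by apply: ginj; rewrite ?g1Y ?g2Y ?P1 ?P2.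
split=> //.
- move=> n w; apply: joint_eq.
    by rewrite g1Y (va_vacuum (gm_action W1)); case: ifP => _; rewrite ?linear0.
  by rewrite g2Y (va_vacuum (gm_action W2)); case: ifP => _; rewrite ?linear0.
- apply/jacobiP => u v w l m n; apply: ginj.
    by rewrite (jacobi_defect_morph g1Y trunc); apply: ((jacobiP _).1 (va_jacobi (gm_action W1))).
  by rewrite (jacobi_defect_morph g2Y trunc); apply: ((jacobiP _).1 (va_jacobi (gm_action W2))).
- apply/virasoroP => m n w; apply: ginj.
    by rewrite (virasoro_defect_morph g1Y); apply: ((virasoroP _).1 (va_virasoro (gm_action W1))).
  by rewrite (virasoro_defect_morph g2Y); apply: ((virasoroP _).1 (va_virasoro (gm_action W2))).
- move=> n u w; apply: joint_eq.
    by rewrite g1Y linearZ /= g1Y; apply: va_derivative (gm_action W1) _ _ _.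
  by rewrite g2Y linearZ /= g2Y; apply: va_derivative (gm_action W2) _ _ _.
Qed.

Lemma joint_fin w : finite_set [set i | prQ i w != 0].
Proof.
apply: (@sub_finite_set _ _ ([set i | gm_gr W1 i (g1 w) != 0] `|`
                             [set i | gm_gr W2 i (g2 w) != 0])).
  move=> i /= h; have [h1|] := eqVneq (gm_gr W1 i (g1 w)) 0; last by left.
  have [h2|] := eqVneq (gm_gr W2 i (g2 w)) 0; last by right.
  by move: h; rewrite (ginj (x := prQ i w)) ?g1pr ?g2pr// eqxx.
by rewrite finite_setU; split; apply: gproj_fin.
Qed.

Definition joint_grading : grading Q C.
Proof.
exists prQ.
- by move=> i w; apply: joint_eq; rewrite ?g1pr ?g2pr gproj_idem.
- by move=> i j w ij; apply: joint_eq; rewrite ?g1pr ?g2pr gproj_orth ?linear0.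
- exact: joint_fin.
- move=> w; have fw := joint_fin w; apply: joint_eq.
    rewrite fsum_morph //= [LHS](gproj_sum (gm_gr W1)).
    by apply: eq_fsum => i; rewrite g1pr.
  rewrite fsum_morph //= [LHS](gproj_sum (gm_gr W2)).
  by apply: eq_fsum => i; rewrite g2pr.
Defined.

Lemma joint_geneig (n : C) (w : Q) : homog joint_grading n w <->
  exists k : nat, iter k (fun x => vir (voa_omega V) YQ 0 x - n *: x) w = 0.
Proof.
have iter1 k : g1 (iter k (fun x => vir (voa_omega V) YQ 0 x - n *: x) w) =
    iter k (fun x => vir (voa_omega V) (gm_Y W1) 0 x - n *: x) (g1 w).
  by elim: k => //= k <-; rewrite linearB linearZ /vir g1Y.
have iter2 k : g2 (iter k (fun x => vir (voa_omega V) YQ 0 x - n *: x) w) =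
    iter k (fun x => vir (voa_omega V) (gm_Y W2) 0 x - n *: x) (g2 w).
  by elim: k => //= k <-; rewrite linearB linearZ /vir g2Y.
have itl (W : genmod V) k l (x : W) :
    iter k (fun x => vir (voa_omega V) (gm_Y W) 0 x - n *: x) x = 0 ->
    iter (l + k) (fun x => vir (voa_omega V) (gm_Y W) 0 x - n *: x) x = 0.
  by rewrite iterD => ->; elim: l => //= l ->; rewrite /vir linear0r scaler0 subr0.
split=> [wn|[k wk]].
  have [|k1 /itl e1] := (gm_geneig n (g1 w)).1; first by rewrite /homog /= -g1pr wn.
  have [|k2 /itl e2] := (gm_geneig n (g2 w)).1; first by rewrite /homog /= -g2pr wn.
  (* The two images may need different exponents; the sum serves both. *)
  exists (k1 + k2)%N; apply: ginj; last by rewrite iter2 e2.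
  by rewrite iter1 addnC e1.
apply: joint_eq; rewrite ?g1pr ?g2pr; apply/gm_geneig; exists k.
  by rewrite -iter1 wk linear0.
by rewrite -iter2 wk linear0.
Qed.

Definition joint_genmod : genmod V := GenMod joint_action joint_geneig.
End JointlyInjective.

Section LspanMap.
Variables (K : fieldType) (A B : lmodType K) (g : {linear A -> B}).

Lemma lspan_map (s : seq A) x : lspan [set` s] x -> lspan [set` map g s] (g x).
Proof.
have subm : subspace (lspan [set` map g s]) := subspace_lspan _.
apply: (@lspan_min _ _ _ [set x | lspan [set` map g s] (g x)]).
  split=> [|a y z /= gy gz]; first by rewrite /= linear0; apply: subspace0.
  by rewrite /= linearP; apply: subspaceD => //; apply: subspaceZ.
by move=> y /= ys; apply: lspan_gen => /=; apply: map_f.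
Qed.

Lemma lspan_mapP (s : seq A) y : lspan [set` map g s] y ->
  exists2 x, lspan [set` s] x & g x = y.
Proof.
have subs : subspace (lspan [set` s]) := subspace_lspan _.
apply: (@lspan_min _ _ _ [set y | exists2 x, lspan [set` s] x & g x = y]).
  split=> [|a _ _ [x sx <-] [y' sy <-]]; first by exists 0; rewrite ?linear0//; apply: subspace0.
  exists (a *: x + y'); last by rewrite linearP.
  by apply: subspaceD => //; apply: subspaceZ.
by move=> _ /= /mapP[x xs ->]; exists x => //; apply: lspan_gen.
Qed.
End LspanMap.

Section SubModule.
Variables (R : realType) (V : voa R) (W : genmod V) (S : set W).
Hypothesis subS : submodule S.
Local Notation C := R[i].

Definition submodule_space : subspace_of W := Subspace (submodule_subspace subS).
Local Notation Q := (sub_type submodule_space).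

Definition sub_val : {linear Q -> W} := \val.

Lemma sub_Y_closed k u (x : Q) : S (gm_Y W k u (val x)).
Proof. by case: subS => _ _; apply; apply: (sub_typeP x). Qed.

Definition sub_Y_fun k u (x : Q) : Q := mk_sub (S := submodule_space) (sub_Y_closed k u x).

Lemma sub_Y_bilinear k : bilinear_for *:%R *:%R (sub_Y_fun k).
Proof.
split=> [x a u v|u a x y]; apply: val_inj => /=.
  by rewrite linearPl.
by rewrite linearPr.
Qed.

Definition sub_Y : vertex_map V Q := fun k => mk_bilinear (sub_Y_bilinear k).

Lemma sub_pr_closed n (x : Q) : S (gm_gr W n (val x)).
Proof. by apply: submodule_gproj subS _; apply: (sub_typeP x). Qed.

Definition sub_pr_fun n (x : Q) : Q := mk_sub (S := submodule_space) (sub_pr_closed n x).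

Lemma sub_pr_linear n : linear (sub_pr_fun n).
Proof. by move=> a x y; apply: val_inj; rewrite /= linearP. Qed.

Definition sub_pr n := mk_linear (sub_pr_linear n).

Lemma sub_joint_inj (x : Q) : sub_val x = 0 -> sub_val x = 0 -> x = 0.
Proof. by move=> x0 _; apply: val_inj. Qed.

Definition sub_genmod : genmod V :=
  @joint_genmod R V Q sub_Y sub_pr W W sub_val sub_val
    (fun k u x => erefl) (fun k u x => erefl) (fun n x => erefl) (fun n x => erefl)
    sub_joint_inj.

Definition sub_incl : {linear sub_genmod -> W} := sub_val.

Lemma sub_incl_inj : injective sub_incl. Proof. exact: val_inj. Qed.

Lemma sub_inclP (x : sub_genmod) : S (sub_incl x).
Proof. exact: (sub_typeP x). Qed.

Lemma sub_incl_Y k u (x : sub_genmod) :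
  sub_incl (gm_Y sub_genmod k u x) = gm_Y W k u (sub_incl x).
Proof. by []. Qed.

Lemma sub_incl_gr n (x : sub_genmod) :
  sub_incl (gm_gr sub_genmod n x) = gm_gr W n (sub_incl x).
Proof. by []. Qed.

Definition sub_elt x (Sx : S x) : sub_genmod := mk_sub (S := submodule_space) Sx.

Lemma sub_eltK x (Sx : S x) : sub_incl (sub_elt Sx) = x. Proof. by []. Qed.

Lemma sub_homog n (x : sub_genmod) :
  homog (gm_gr sub_genmod) n x <-> homog (gm_gr W) n (sub_incl x).
Proof.
split=> h; first by rewrite /homog /= -sub_incl_gr h.
by apply: sub_incl_inj; rewrite sub_incl_gr h.
Qed.

Lemma sub_grading_restricted : grading_restricted W -> grading_restricted sub_genmod.
Proof.
move=> [[r rP] fd]; split.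
  by exists r => n w nr; apply: sub_incl_inj; rewrite sub_incl_gr rP// linear0.
move=> n; have [s sP] := fd n.
have subI : subspace (S `&` homog (gm_gr W) n).
  by apply: subspaceI (submodule_subspace subS) (homog_subspace _ _).
(* Generators of W_[n] need not lie in S, so they are first exchanged for generators of its
   intersection with S, which are elements of the submodule type. *)
have [t tS tP] := subspace_basis subI (fun x h => sP x h.2).
have tE : t = map sub_incl (pmap insub t).
  rewrite [RHS](pmap_filter (@insubK _ _ _)); apply/esym/all_filterP/allP => x /tS[Sx _].
  by rewrite isSome_insub; apply/asboolP.
exists (pmap insub t) => x /sub_homog xn.
have /tP : (S `&` homog (gm_gr W) n) (sub_incl x) by split=> //; apply: sub_inclP.
by rewrite {1}tE => /lspan_mapP[y sy /sub_incl_inj <-].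
Qed.
End SubModule.

Section DirectSum.
Variables (R : realType) (V : voa R) (W1 W2 : genmod V).
Local Notation C := R[i].
Local Notation Q := (W1 * W2)%type.

Definition sum_Y_fun k u (x : Q) : Q := (gm_Y W1 k u x.1, gm_Y W2 k u x.2).

Lemma sum_Y_bilinear k : bilinear_for *:%R *:%R (sum_Y_fun k).
Proof.
split=> [x a u v|u a x y]; rewrite /sum_Y_fun.
  by rewrite !linearPl.
by rewrite /= !linearPr.
Qed.

Definition sum_Y : vertex_map V Q := fun k => mk_bilinear (sum_Y_bilinear k).

Definition sum_pr_fun n (x : Q) : Q := (gm_gr W1 n x.1, gm_gr W2 n x.2).

Lemma sum_pr_linear n : linear (sum_pr_fun n).
Proof. by move=> a x y; rewrite /sum_pr_fun /= !linearP. Qed.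

Definition sum_pr n := mk_linear (sum_pr_linear n).

Lemma fst_linear : linear (fun x : Q => x.1). Proof. by []. Qed.
Lemma snd_linear : linear (fun x : Q => x.2). Proof. by []. Qed.
Definition sum_fst : {linear Q -> W1} := mk_linear fst_linear.
Definition sum_snd : {linear Q -> W2} := mk_linear snd_linear.

Lemma sum_joint_inj (x : Q) : sum_fst x = 0 -> sum_snd x = 0 -> x = 0.
Proof. by case: x => x y /= -> ->. Qed.

Definition sum_genmod : genmod V :=
  @joint_genmod R V Q sum_Y sum_pr W1 W2 sum_fst sum_snd
    (fun k u x => erefl) (fun k u x => erefl) (fun n x => erefl) (fun n x => erefl)
    sum_joint_inj.

Definition sum_pr1 : {linear sum_genmod -> W1} := sum_fst.
Definition sum_pr2 : {linear sum_genmod -> W2} := sum_snd.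

Lemma inl_linear : linear (fun x : W1 => (x, 0) : Q).
Proof. by move=> a x y; congr pair; rewrite /= scaler0 addr0. Qed.
Lemma inr_linear : linear (fun x : W2 => (0, x) : Q).
Proof. by move=> a x y; congr pair; rewrite /= scaler0 addr0. Qed.
Definition sum_inl : {linear W1 -> sum_genmod} := mk_linear inl_linear.
Definition sum_inr : {linear W2 -> sum_genmod} := mk_linear inr_linear.

Lemma sum_homog n (x : sum_genmod) : homog (gm_gr sum_genmod) n x <->
  homog (gm_gr W1) n (sum_pr1 x) /\ homog (gm_gr W2) n (sum_pr2 x).
Proof.
case: x => x y; rewrite /homog /=; split=> [[e1 e2]|[e1 e2]]; first by split.
by rewrite -[in RHS]e1 -[in RHS]e2.
Qed.

Lemma sum_grading_restricted : grading_restricted W1 -> grading_restricted W2 ->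
  grading_restricted sum_genmod.
Proof.
move=> [[r1 P1] fd1] [[r2 P2] fd2]; split.
  exists (Num.min r1 r2) => n w; rewrite lt_min => /andP[n1 n2].
  by apply: sum_joint_inj; [apply: P1|apply: P2].
move=> n; have [s1 sP1] := fd1 n; have [s2 sP2] := fd2 n.
exists (map sum_inl s1 ++ map sum_inr s2) => x /sum_homog[/sP1 x1 /sP2 x2].
have -> : x = sum_inl (sum_pr1 x) + sum_inr (sum_pr2 x).
  by apply: joint_eq sum_joint_inj _ _ _ _; rewrite /= ?addr0 ?add0r.
apply: subspaceD; first exact: subspace_lspan.
  by apply: lspan_mono (lspan_map sum_inl x1) => y /= ys; rewrite mem_cat ys.
by apply: lspan_mono (lspan_map sum_inr x2) => y /= ys; rewrite mem_cat ys orbT.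
Qed.
End DirectSum.

Section QuotientModule.
Variables (R : realType) (V : voa R) (W : genmod V) (S : set W).
Hypothesis subS : submodule S.
Local Notation C := R[i].
Local Notation Q := (quot_type (submodule_space subS)).
Local Notation pi := (quot_pi (submodule_space subS)).

Lemma quot_pi_eq x y : pi x = pi y <-> S (x - y).
Proof.
rewrite -[S _]/(sub_set (submodule_space subS) _) -quot_pi_eq0 linearB.
by split=> [->|/eqP]; rewrite ?subrr// subr_eq0 => /eqP.
Qed.

Definition quot_section (q : Q) : W := projT1 (cid (quot_pi_surj q)).

Lemma quot_sectionK q : pi (quot_section q) = q.
Proof. by rewrite /quot_section; case: cid. Qed.

Definition quot_lift (f : W -> W) (q : Q) : Q := pi (f (quot_section q)).

Lemma quot_lift_pi (f : {linear W -> W}) x : (forall y, S y -> S (f y)) ->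
  quot_lift f (pi x) = pi (f x).
Proof.
by move=> Sf; apply/quot_pi_eq; rewrite -linearB; apply/Sf/quot_pi_eq/quot_sectionK.
Qed.

Definition quot_Y_fun k u : Q -> Q := quot_lift (gm_Y W k u).

Lemma quot_Y_pi k u x : quot_Y_fun k u (pi x) = pi (gm_Y W k u x).
Proof. by apply: quot_lift_pi => y Sy; case: subS => _ _; apply. Qed.

Lemma quot_Y_bilinear k : bilinear_for *:%R *:%R (quot_Y_fun k).
Proof.
split=> [q a u v|u a p q].
  by rewrite -[q]quot_sectionK !quot_Y_pi linearPl linearP.
rewrite -[p]quot_sectionK -[q]quot_sectionK -linearP !quot_Y_pi linearPr.
by rewrite [LHS]linearP.
Qed.

Definition quot_Y : vertex_map V Q := fun k => mk_bilinear (quot_Y_bilinear k).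

Definition quot_pr_fun n : Q -> Q := quot_lift (gm_gr W n).

Lemma quot_pr_pi n x : quot_pr_fun n (pi x) = pi (gm_gr W n x).
Proof. by apply: quot_lift_pi => y; apply: submodule_gproj subS. Qed.

Lemma quot_pr_linear n : linear (quot_pr_fun n).
Proof.
move=> a p q; rewrite -[p]quot_sectionK -[q]quot_sectionK -linearP !quot_pr_pi.
by rewrite linearP [LHS]linearP.
Qed.

Definition quot_pr n : {linear Q -> Q} := mk_linear (quot_pr_linear n).

Lemma quot_prE n x : quot_pr n (pi x) = pi (gm_gr W n x).
Proof. exact: quot_pr_pi. Qed.

Lemma quot_action :
  vertex_action (voa_Y V) (voa_vac V) (voa_omega V) (voa_charge V) quot_Y.
Proof.
have piY k u x : pi (gm_Y W k u x) = quot_Y k u (pi x) by rewrite /= quot_Y_pi.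
have trW : truncated (gm_Y W) := va_truncation (gm_action W).
split.
- move=> u q; rewrite -[q]quot_sectionK.
  have [N P] := va_truncation (gm_action W) u (quot_section q).
  by exists N => n /P e; rewrite -piY e linear0.
- move=> n q; rewrite -[q]quot_sectionK -piY (va_vacuum (gm_action W)).
  by case: ifP; rewrite ?linear0.
- apply/jacobiP => u v q l m n; rewrite -[q]quot_sectionK.
  rewrite -(jacobi_defect_morph piY trW).
  by rewrite ((jacobiP _).1 (va_jacobi (gm_action W))) linear0.
- apply/virasoroP => m n q; rewrite -[q]quot_sectionK -(virasoro_defect_morph piY).
  by rewrite ((virasoroP _).1 (va_virasoro (gm_action W))) linear0.
- move=> n u q; rewrite -[q]quot_sectionK -!piY.
  by rewrite (va_derivative (gm_action W)) linearZ.
Qed.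

Lemma quot_fin q : finite_set [set i | quot_pr i q != 0].
Proof.
rewrite -[q]quot_sectionK; set x := quot_section q.
apply: sub_finite_set (gproj_fin (gm_gr W) x) => i.
by rewrite /mkset quot_prE; apply: contra_neq => ->; rewrite linear0.
Qed.

Definition quot_grading : grading Q C.
Proof.
exists quot_pr.
- move=> i q; rewrite -[q]quot_sectionK; move: (quot_section q) => x.
  by rewrite (quot_prE i x) (quot_prE i (gm_gr W i x)) gproj_idem.
- move=> i j q ij; rewrite -[q]quot_sectionK; move: (quot_section q) => x.
  by rewrite (quot_prE j x) (quot_prE i (gm_gr W j x)) gproj_orth ?linear0.
- exact: quot_fin.
- move=> q; rewrite -[q]quot_sectionK; move: (quot_section q) => x.
  rewrite {1}(gproj_sum (gm_gr W) x) fsum_morph; last exact: gproj_fin.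
  by apply: eq_fsum => i; apply/esym/quot_prE.
Defined.

Lemma quot_homog_pi n x :
  homog quot_grading n (pi x) <-> pi (gm_gr W n x) = pi x.
Proof. by rewrite -quot_prE. Qed.

(** Only one direction descends from W directly: when q is killed by a power of L(0) - n, a lift of
    q need not be. The converse uses the independence of generalized eigenspaces in the quotient. *)
Lemma quot_geneig (n : C) (q : Q) : homog quot_grading n q <->
  exists k : nat, iter k (fun x => vir (voa_omega V) quot_Y 0 x - n *: x) q = 0.
Proof.
pose L : {linear Q -> Q} := quot_Y 1 (voa_omega V).
have shiftE m : (fun x => vir (voa_omega V) quot_Y 0 x - m *: x) = shift L m by [].
rewrite shiftE {shiftE}.
have iter_pi k m x : iter k (shift L m) (pi x) = pi (iter k (shift (L0 W) m) x).
  elim: k => // k IH; rewrite !iterS IH /shift [RHS]linearB [X in _ = _ - X]linearZ.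
  by congr (_ - _); apply: quot_Y_pi.
have [x <-] : exists x, pi x = q by exists (quot_section q); apply: quot_sectionK.
have prn m : homog quot_grading m (pi (gm_gr W m x)).
  by apply/quot_homog_pi; rewrite gproj_idem.
have kill m : exists k, iter k (shift L m) (pi (gm_gr W m x)) = 0.
  have [k kx] := (homogP m (gm_gr W m x)).1 (homog_gproj _ _ _).
  by exists k; rewrite iter_pi kx linear0.
split=> [/quot_homog_pi <-|[k kq]]; first exact: kill.
apply/quot_homog_pi.
have [r0 ur0 rP0] := grading_support (gm_gr W) x.
pose r := undup (n :: r0); have ur : uniq r := undup_uniq _.
have nr : n \in r by rewrite mem_undup mem_head.
have rP i : gm_gr W i x != 0 -> i \in r by move=> /rP0; rewrite mem_undup inE orbC => ->.
(* The y m are generalized eigenvectors for distinct eigenvalues and add up to 0, so each vanishes;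
   y n = 0 says that q equals its component of degree n. *)
pose y m := if m == n then pi (gm_gr W n x) - pi x else pi (gm_gr W m x).
have /choice[k' k'P] : forall m, exists k, iter k (shift L m) (y m) = 0.
  move=> m; rewrite /y; case: eqVneq => [->|_ //]; have [j jx] := kill n.
  have iterB l a b : iter l (shift L n) (a - b) =
      iter l (shift L n) a - iter l (shift L n) b.
    by elim: l => //= l ->; rewrite linearB.
  have iter0 l : iter l (shift L n) 0 = 0 by elim: l => //= l ->; rewrite linear0.
  exists (j + k)%N; rewrite iterB [in X in _ - X]iterD kq iter0.
  by rewrite addnC iterD jx iter0 subr0.
have sub0 : subspace [set 0 : Q].
  by split=> // a u v -> ->; rewrite /= scaler0 addr0.
have := geneig_components (L := L) (x := y) (k := k') sub0 _ ur (fun i _ => k'P i).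
move=> /(_ _ _ n nr); rewrite /y eqxx => h; apply/eqP; rewrite -subr_eq0; apply/eqP/h.
  by move=> w ->; apply: (linear0 L).
rewrite [X in set1 _ X](_ : _ = \sum_(i <- r) pi (gm_gr W i x) - pi x).
  by rewrite -(linear_sum pi) -(gproj_seq ur rP) subrr.
rewrite !(bigD1_seq n nr ur) eqxx addrAC; congr (_ + _).
by apply: eq_bigr => m /negPf ->.
Qed.

Definition quot_genmod : genmod V := GenMod quot_action quot_geneig.

Definition quot_proj : {linear W -> quot_genmod} := pi.

Lemma quot_proj_surj (q : quot_genmod) : exists x, quot_proj x = q.
Proof. by exists (quot_section q); apply: quot_sectionK. Qed.

Lemma quot_proj_eq0 x : quot_proj x = 0 <-> S x.
Proof. exact: quot_pi_eq0. Qed.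

Lemma quot_proj_Y k u x : quot_proj (gm_Y W k u x) = gm_Y quot_genmod k u (quot_proj x).
Proof. by rewrite /= quot_Y_pi. Qed.

Lemma quot_proj_gr n x : quot_proj (gm_gr W n x) = gm_gr quot_genmod n (quot_proj x).
Proof. by rewrite quot_prE. Qed.

Lemma quot_homog n (q : quot_genmod) : homog (gm_gr quot_genmod) n q ->
  exists2 x, homog (gm_gr W) n x & quot_proj x = q.
Proof.
have [x <-] := quot_proj_surj q => qn; exists (gm_gr W n x).
  exact: homog_gproj.
by rewrite quot_proj_gr.
Qed.

Lemma quot_grading_restricted : grading_restricted W -> grading_restricted quot_genmod.
Proof.
move=> [[r rP] fd]; split.
  exists r => n w nr; have [x <-] := quot_proj_surj w.
  by rewrite -quot_proj_gr rP// linear0.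
move=> n; have [s sP] := fd n; exists (map quot_proj s) => _ /quot_homog[x /sP xs <-].
exact: lspan_map.
Qed.
End QuotientModule.

(** * Cofiniteness *)

Section C1Generators.
Variables (R : realType) (V : voa R).
Local Notation C := R[i].

Definition C1_homog (W : genmod V) (n : C) : set W :=
  lspan [set x | exists (h : nat) u w, [/\ (0 < h)%N, homog (voa_gr V) h u,
    homog (gm_gr W) (n - h%:R) w & x = gm_Y W (-1) u w]].

(** A homogeneous form of cofiniteness: both summands keep the weight n of w, as an induction on
    weights requires. *)
Definition C1_generators (W : genmod V) (M : seq W) :=
  forall n w, homog (gm_gr W) n w -> exists c e, [/\ C1_homog n c,
    lspan [set m | m \in M /\ homog (gm_gr W) n m] e & w = c + e].

(** M consists of the homogeneous components of finitely many vectors spanning W modulo C_1(W).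
    Projecting a decomposition of w to weight n keeps its shape, since u_(-1)w is homogeneous for
    homogeneous u and w. *)
Lemma C1_generators_exist (W : genmod V) : C1_cofinite W ->
  exists M : seq W, C1_generators M.
Proof.
move=> [s sP].
have /choice[r rP] : forall x : W, exists r : seq C, forall i, gm_gr W i x != 0 -> i \in r.
  by move=> x; have [r _ rP] := grading_support (gm_gr W) x; exists r.
pose M := flatten [seq [seq gm_gr W i x | i <- r x] | x <- s].
exists M => n w wn; have [c Cc ce] := sP w.
exists (gm_gr W n c), (gm_gr W n (w - c)); split; last by rewrite -linearD addrC subrK.
- have subC : subspace (@C1_homog W n) := subspace_lspan _.
  apply: (@lspan_min _ _ _ [set c | C1_homog n (gm_gr W n c)]) Cc.
    exact: subspace_preim (linearP _) _.
  move=> _ [u [x [up ->]]] /=.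
  apply: (grading_ind (g := voa_gr V) (S := [set u | C1_homog n (gm_gr W n (gm_Y W (-1) u x))])).
    by apply: subspace_preim => // a x1 x2; rewrite linearPl linearP.
  move=> h /=; have [h0|h0] := lerP h 0.
    by rewrite (up h h0) linear0l linear0; apply: subspace0.
  apply: (grading_ind (g := gm_gr W)
    (S := [set x | C1_homog n (gm_gr W n (gm_Y W (-1) (voa_gr V h u) x))])).
    by apply: subspace_preim => // a x1 x2; rewrite linearPr linearP.
  move=> j /=.
  have := homog_op (-1) (homog_gproj (voa_gr V) h u) (homog_gproj (gm_gr W) j x).
  rewrite (_ : h - (-1) - 1 = h) => [hom|]; last by lia.
  rewrite (gproj_homog _ hom); case: eqVneq => [nE|_]; last exact: subspace0.
  apply: lspan_gen; exists `|h|%N, (voa_gr V h u), (gm_gr W j x).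
  have hE : (`|h|%N)%:Z = h by lia.
  split=> //; first by lia.
    by rewrite hE; apply: homog_gproj.
  have -> : n - `|h|%N%:R = j by rewrite nE (pmulrn _ `|h|) hE addrK.
  exact: homog_gproj.
- pose E := [set m | m \in M /\ homog (gm_gr W) n m].
  have subE : subspace (lspan E) := subspace_lspan _.
  apply: (@lspan_min _ _ _ [set e | lspan E (gm_gr W n e)]) ce.
    exact: subspace_preim (linearP _) _.
  move=> x /= xs; have [->|gx] := eqVneq (gm_gr W n x) 0; first exact: subspace0.
  apply: lspan_gen; split; last exact: homog_gproj.
  by apply/flatten_mapP; exists x => //; apply: map_f; apply: rP.
Qed.
End C1Generators.

Section Cofiniteness.
Variables (R : realType) (V : voa R) (P : seq R[i]).
Local Notation C := R[i].

Definition lowest_weights := forall (W : genmod V) (S : set W) m x,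
  lower_truncated W -> submodule S -> x != 0 -> S x -> homog (gm_gr W) m x ->
  exists k : nat, m - k%:R \in P /\
    exists y, [/\ S y, y != 0 & homog (gm_gr W) (m - k%:R) y].
Hypothesis HP : lowest_weights.

Definition part (W : genmod V) : set W :=
  [set w | forall n, n \notin P -> gm_gr W n w = 0].

Lemma part_homog (W : genmod V) p (w : W) : p \in P -> homog (gm_gr W) p w -> part w.
Proof.
move=> pP wp n nP; rewrite (gproj_homog _ wp); case: eqVneq => // np.
by rewrite np pP in nP.
Qed.

Lemma part_sum (W : genmod V) (w : W) : part w -> w = \sum_(p <- undup P) gm_gr W p w.
Proof.
move=> wP; apply: gproj_seq (undup_uniq _) _ => i; rewrite mem_undup.
by apply: contraR => /wP ->.
Qed.

Lemma part_proj (W : genmod V) (w : W) : part (\sum_(p <- undup P) gm_gr W p w).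
Proof.
move=> n nP; rewrite linear_sum big_seq big1// => p; rewrite mem_undup => pP /=.
rewrite gproj_orth//; by apply: contraNneq nP => ->.
Qed.

Lemma submodule_part (W : genmod V) (S : set W) w : submodule S ->
  lower_truncated W -> w != 0 -> S w ->
  exists y, [/\ S y, y != 0 & part y].
Proof.
move=> subS Wl w0 Sw; have [m wm0] := gproj_neq0 (gm_gr W) w0.
have [k [kP [y [Sy y0 yk]]]] :=
  HP Wl subS wm0 (submodule_gproj m subS Sw) (homog_gproj _ _ _).
by exists y; split => //; apply: part_homog yk.
Qed.

Lemma submoduleT (W : genmod V) : submodule [set: W]. Proof. by []. Qed.

Lemma part_fin (W : genmod V) : grading_restricted W ->
  exists s : seq W, @part W `<=` lspan [set` s].
Proof.
move=> [_ fd]; have /choice[s sP] := fd.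
exists (flatten [seq s p | p <- P]) => w /part_sum ->.
rewrite big_seq; apply: subspace_sum => [|p]; first exact: subspace_lspan.
rewrite mem_undup => pP; apply: lspan_mono (sP p _ (homog_gproj _ _ _)) => x /= xs.
by apply/flattenP; exists (s p) => //; apply: map_f.
Qed.

(** Any lift, cut down to the degrees in P, is still a lift. With [sub_part] this allows independent
    vectors of a submodule and of its quotient to be compared inside W. *)
Lemma quot_part (W : genmod V) (S : set W) (subS : submodule S) (q : quot_genmod subS) :
  part q -> exists2 w, part w & quot_proj subS w = q.
Proof.
move=> qP; have [x xq] := quot_proj_surj q; exists (\sum_(p <- undup P) gm_gr W p x).
  exact: part_proj.
rewrite linear_sum [RHS](part_sum qP) -xq; apply: eq_bigr => p _.
exact: quot_proj_gr.
Qed.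

Lemma sub_part (W : genmod V) (S : set W) (subS : submodule S) (x : sub_genmod subS) :
  part x -> part (sub_incl subS x).
Proof. by move=> xP n /xP e; rewrite -sub_incl_gr e linear0. Qed.

(** Modes of homogeneous u send eigenvectors to eigenvectors. Hence in a simple module this span is
    everything, and L(0) is semisimple. *)
Lemma eigenvectors_span (W : genmod V) :
  submodule (lspan [set x : W | exists a : C, vir (voa_omega V) (gm_Y W) 0 x = a *: x]).
Proof.
set E := [set x | _]; have subE : subspace (lspan E) := subspace_lspan _.
split; [exact: subspace0|by case: subE|move=> k u].
apply: (@lspan_min _ _ _ [set x | lspan E (gm_Y W k u x)]).
  by apply: subspace_preim => // a x y; rewrite linearPr.
move=> x [a xa] /=.
apply: (grading_ind (g := voa_gr V) (S := [set u | lspan E (gm_Y W k u x)])).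
  by apply: subspace_preim => // b y t; rewrite linearPl.
move=> h /=; apply: lspan_gen; exists (a + (h - k - 1)%:~R).
have /eqP := va_commL0 (gm_action W) k x (voa_homogL0 (homog_gproj (voa_gr V) h u)).
move: xa; rewrite /vir add0r => ->; rewrite linearZr_LR subr_eq -scalerDl => /eqP ->.
by congr (_ *: _); rewrite addrC -rmorphB; congr (_ + _%:~R); lia.
Qed.

Lemma simple_irreducible (W : genmod V) : grading_restricted W ->
  (exists w : W, w <> 0) ->
  (forall S : set W, submodule S -> S = [set 0] \/ S = setT) -> irreducible_module W.
Proof.
move=> Wr [w /eqP w0] simW; split=> //; last by exists w; apply/eqP.
split=> //; move=> x; have := simW _ (eigenvectors_span W).
set E := lspan _; case=> E0; last by have : [set: W] x by []; rewrite -E0.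
have [n wn] := gproj_neq0 (gm_gr W) w0.
have [k kn] := (homogP n _).1 (homog_gproj (gm_gr W) n w).
have [j] := geneig_eigenvector wn kn; set y := iter j _ _ => y0 Ly.
have : E y by apply: lspan_gen; exists n; rewrite /vir add0r.
by rewrite E0 => ye; rewrite ye eqxx in y0.
Qed.

Lemma C1_morph (A B : genmod V) (g : {linear A -> B}) x :
  (forall k u y, g (gm_Y A k u y) = gm_Y B k u (g y)) -> C1 x -> C1 (g x).
Proof.
move=> gY; have subB : subspace (@C1 R V B) := subspace_lspan _.
apply: (@lspan_min _ _ _ [set x | C1 (g x)]).
  exact: subspace_preim (linearP _) _.
by move=> _ [u [w [up ->]]]; apply: lspan_gen; exists u, (g w); rewrite gY.
Qed.

(** C_1 of the quotient lifts into C_1(W), and C_1 of the submodule maps into it. So lifts of the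
    generators t, together with the generators s, span W modulo C_1(W). *)
Lemma C1_cofinite_extension (W : genmod V) (S : set W) (subS : submodule S) :
  C1_cofinite (sub_genmod subS) -> C1_cofinite (quot_genmod subS) -> C1_cofinite W.
Proof.
move=> [s sP] [t tP]; pose pi := quot_proj subS; pose j := sub_incl subS.
have /choice[l lP] : forall q : quot_genmod subS, exists x, pi x = q := @quot_proj_surj _ _ _ _ subS.
have tE : t = map pi (map l t) by rewrite -map_comp map_id_in// => q _; apply: lP.
have subC : subspace (@C1 R V W) := subspace_lspan _.
have C1lift q : C1 q -> exists2 c, C1 c & pi c = q.
  apply: (@lspan_min _ _ _ [set q | exists2 c, C1 c & pi c = q]).
    split=> [|a _ _ [x Cx <-] [y Cy <-]]; first by exists 0; rewrite ?linear0//; apply: subspace0.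
    by exists (a *: x + y); rewrite ?linearP//; apply: subspaceD => //; apply: subspaceZ.
  move=> _ [u [q' [up ->]]]; exists (gm_Y W (-1) u (l q')).
    by apply: lspan_gen; exists u, (l q').
  by rewrite /pi quot_proj_Y -/pi lP.
exists (map l t ++ map j s) => w.
have [q /C1lift[c Cc <-]] := tP (pi w); rewrite {1}tE => /lspan_mapP[e te ce].
have Sx : S (w - c - e).
  apply/quot_proj_eq0; rewrite [LHS]linearB [X in X - _]linearB.
  by apply/eqP; rewrite subr_eq0; apply/eqP/esym.
have [x Cx xs] := sP (sub_elt subS Sx).
have jx : C1 (j x) by apply: C1_morph Cx; apply: sub_incl_Y.
exists (c + j x); first exact: subspaceD.
have -> : w - (c + j x) = e + j (sub_elt subS Sx - x).
  by rewrite (linearB j) [j (sub_elt _ _)]sub_eltK [RHS]addrC addrAC subrK opprD addrA.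
apply: (subspaceD (subspace_lspan _)).
  by apply: lspan_mono te => y /= yt; rewrite mem_cat yt.
by apply: lspan_mono (lspan_map j xs) => y /= yt; rewrite mem_cat yt orbT.
Qed.

(** Induction on a strict bound k for the dimension in degrees P, in place of the length. A proper
    nonzero submodule and its quotient both meet these degrees, so each has a smaller bound. *)
Lemma C1_cofinite_of_bound k (W : genmod V) :
  (forall W : genmod V, irreducible_module W -> C1_cofinite W) ->
  grading_restricted W -> (forall f : 'I_k -> W, (forall i, part (f i)) -> ~ indep f) ->
  C1_cofinite W.
Proof.
move=> Hirr; elim: k W => [|k IH] W Wr bW.
  (* The empty family is independent, so k = 0 contradicts the bound. *)
  by exfalso; apply: (bW (fun=> 0)) => [[]//|c _ []].
have [[w w0]|W0] := pselect (exists w : W, w <> 0); last first.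
  exists [::] => w; exists 0; first exact: subspace0 (subspace_lspan _).
  suff -> : w = 0 by rewrite subr0; apply: subspace0 (subspace_lspan _).
  by apply: contrapT => w0; apply: W0; exists w.
have [simW|] := pselect (forall S : set W, submodule S -> S = [set 0] \/ S = setT).
  by apply/Hirr/simple_irreducible => //; exists w.
move=> /existsNP[S /not_implyP[subS /not_orP[S0 ST]]].
(* The vector a in S extends families lifted from the quotient; b below, outside S, extends families
   coming from S. *)
have [a [Sa a0 aP]] : exists a, [/\ S a, a != 0 & part a].
  have [x Sx x0] : exists2 x, S x & x != 0.
    apply: contrapT => h; apply: S0; apply/seteqP; split=> [x Sx|_ ->]; last by case: subS.
    by apply/eqP; apply: contrapT => /negP x0; apply: h; exists x.
  exact: submodule_part Wr.1 x0 Sx.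
have Qr := quot_grading_restricted subS Wr.
have [b bP b0] : exists2 b, part b & quot_proj subS b != 0.
  have [x Sx] : exists x, ~ S x.
    by apply: contrapT => /forallNP h; apply: ST; apply/seteqP; split=> // x _; apply: contrapT.
  have q0 : quot_proj subS x != 0 by apply/eqP => /quot_proj_eq0.
  have [q [_ q'0 qP]] := submodule_part (@submoduleT _) Qr.1 q0 I.
  by have [b bP bq] := quot_part qP; exists b; rewrite ?bq.
have extP (c : W) (f : 'I_k -> W) : part c -> (forall i, part (f i)) ->
    forall i, part (oapp f c (unlift ord0 i)).
  by move=> cP fP i; case: unliftP => [j _|_] /=.
apply: (C1_cofinite_extension (subS := subS)); apply: IH => //.
- exact: sub_grading_restricted.
- move=> f fP indf; have injf := indep_inj (@sub_incl_inj _ _ _ _ subS) indf.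
  apply: bW (indep_im b0 _ injf); first by apply: extP => // i; apply/sub_part/fP.
  by move=> i; apply/quot_proj_eq0; apply: (sub_inclP (f i)).
- move=> f fP indf.
  have /choice[g gP] : forall i, exists w, part w /\ quot_proj subS w = f i.
    by move=> i; have [x xP xf] := quot_part (fP i); exists x.
  apply: bW (indep_ker (g := quot_proj subS) (f := g) a0 _ _).
  + by apply: extP => // i; apply: (gP i).1.
  + exact/quot_proj_eq0.
  + by rewrite (_ : _ \o g = f)//; apply/funext => i; apply: (gP i).2.
Qed.
End Cofiniteness.

Lemma common_bound (A : eqType) (s : seq A) (Q : A -> nat -> Prop) :
  (forall x, exists M, forall i, (M <= i)%N -> Q x i) ->
  exists M, forall x i, x \in s -> (M <= i)%N -> Q x i.
Proof.
move=> /choice[M MP]; exists (\max_(x <- s) M x) => x i xs Mi; apply: MP.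
by apply: leq_trans Mi; apply: leq_bigmax_seq.
Qed.

(** * Bounding the image of an intertwining map *)

Section Intertwining.
Variables (R : realType) (V : voa R).
Local Notation C := R[i].
Variables (z : C) (W1 W2 T : genmod V) (B : {bilinear W1 -> W2 -> (C -> T)}).
Hypothesis imB : intertwining_map z B.

Lemma completed_op_homog h k u (f : C -> T) n : homog (voa_gr V) h u ->
  in_completion f -> completed_op k u f n = gm_Y T k u (f (n - (h - k - 1)%:~R)).
Proof.
move=> uh fP; rewrite /completed_op (fsum1 (i0 := n - (h - k - 1)%:~R)) => [|p pn].
  by have := homog_op k uh (fP (n - (h - k - 1)%:~R)); rewrite subrK.
rewrite (gproj_homog _ (homog_op k uh (fP p))); case: eqVneq => // nE.
by rewrite nE addrK eqxx in pn.
Qed.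

(** The Jacobi identity at l = 0. Since u is homogeneous, u_k reaches degree n from a single
    component of the product, that of degree n - (h - k - 1). *)
Lemma intertwining_commutator h k u w1 w2 n : homog (voa_gr V) h u ->
  gm_Y T k u (B w1 w2 (n - (h - k - 1)%:~R)) =
  \sum_(i \in [set: nat]) (subexp R (i%:Z - k - 1) i * z ^ (k - i%:Z))
      *: B (gm_Y W1 i%:Z u w1) w2 n
  + B w1 (gm_Y W2 k u w2) n.
Proof.
move=> uh; have := im_jacobi imB u w1 w2 0 k n.
rewrite [X in X = _](fsum1 (i0 := 0%N)) => [|i i0]; last first.
  by rewrite subexp_0n ?lt0n// mul0r scale0r.
rewrite [X in _ = _ + X](fsum1 (i0 := 0%N)) => [|i i0]; last first.
  by rewrite subexp_0n ?lt0n// mulr0 mul0r scale0r.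
rewrite !subexp_n0 add0r !subz0 expr0 !expr0z !mulr1 !scale1r.
rewrite (completed_op_homog _ _ uh (im_completion imB _ _)) => ->.
by congr (_ + _); apply: eq_fsum => i; rewrite add0r.
Qed.

(** The Jacobi identity at l = -1, m = 0, solved for its only term in which u acts on w1. *)
Lemma intertwining_iterate h u w1 w2 n : homog (voa_gr V) h u ->
  B (gm_Y W1 (-1) u w1) w2 n =
  \sum_(i \in [set: nat]) (subexp R (-1) i * z ^+ i) *:
     gm_Y T (-1 - i%:Z) u (B w1 w2 (n - (h + i%:Z)%:~R))
  - \sum_(i \in [set: nat]) ((-1) ^ (-1) * subexp R (-1) i * z ^ (-1 - i%:Z)) *:
     B w1 (gm_Y W2 i%:Z u w2) n.
Proof.
move=> uh; have := im_jacobi imB u w1 w2 (-1) 0 n.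
rewrite [X in _ = X + _](fsum1 (i0 := 0%N)) => [|i i0]; last first.
  by rewrite subexp_neg (@binz_nat_eq0 R 0) ?lt0n// mul0r scale0r.
rewrite !subz0 subexp_n0 expr0z mul1r scale1r => e.
apply/eqP; rewrite -subr_eq opprK; apply/eqP.
have -> : B (gm_Y W1 (-1) u w1) w2 n = B (gm_Y W1 (-1 + 0%Z) u w1) w2 n by [].
rewrite (eq_fsum (y := fun i : nat => ((-1) ^ (-1) * subexp R (-1) i * z ^ (-1 - i%:Z)) *:
  B w1 (gm_Y W2 (0 + i%:Z) u w2) n)) => [|i]; last by rewrite add0r.
rewrite -e; apply: eq_fsum => i; congr (_ *: _).
rewrite (completed_op_homog _ _ uh (im_completion imB _ _)) ?addr0.
by congr (gm_Y _ _ _ (B _ _ (_ - _%:~R))); lia.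
Qed.

Definition im_span : set T := lspan [set t | exists w1 w2 n, t = B w1 w2 n].

(** By the commutator formula, u_k of a component of a product is a combination of components of
    products. *)
Lemma im_span_submodule : submodule im_span.
Proof.
have subI : subspace im_span := subspace_lspan _.
split; [exact: subspace0|by case: subI|move=> k u].
apply: (@lspan_min _ _ _ [set x | im_span (gm_Y T k u x)]).
  by apply: subspace_preim => // a x y; rewrite linearPr.
move=> _ [w1 [w2 [n ->]]] /=.
apply: (grading_ind (g := voa_gr V) (S := [set u | im_span (gm_Y T k u (B w1 w2 n))])).
  by apply: subspace_preim => // a x y; rewrite linearPl.
move=> h /=; have uh := homog_gproj (voa_gr V) h u.
rewrite -[n](addrK (h - k - 1)%:~R) (intertwining_commutator _ _ _ _ uh).
apply: subspaceD => //; last by apply: lspan_gen; do 3!eexists.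
by apply: subspace_fsum => // i; apply: subspaceZ => //; apply: lspan_gen; do 3!eexists.
Qed.

Section Functional.
(* phi, applied to the components of degree q in Q, is a map out of the completion. *)
Variables (phi : {linear T -> T}) (Q : seq C).

Definition pairing w1 w2 := \sum_(q <- Q) phi (B w1 w2 q).

Lemma pairing_linearl w2 : linear (pairing^~ w2).
Proof.
move=> a x y; rewrite /pairing scaler_sumr -big_split; apply: eq_bigr => q _ /=.
by rewrite linearPl [LHS]linearP.
Qed.

Lemma pairing_linearr w1 : linear (pairing w1).
Proof.
move=> a x y; rewrite /pairing scaler_sumr -big_split; apply: eq_bigr => q _ /=.
by rewrite linearPr [LHS]linearP.
Qed.

Lemma fsum_pairing (S : set T) (F : nat -> C -> T) : subspace S ->
  (forall q, exists N, forall i, (N <= i)%N -> F i q = 0) ->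
  (forall i, S (\sum_(q <- Q) phi (F i q))) ->
  S (\sum_(q <- Q) phi (\sum_(i \in [set: nat]) F i q)).
Proof.
move=> subS finF SF; have [M MP] := common_bound Q finF.
rewrite big_seq (eq_bigr (fun q => \sum_(i < M) phi (F i q))) => [|q qQ].
  by rewrite -big_seq exchange_big; apply: subspace_sum => // i _; apply: SF.
by rewrite (@fsum_nat _ _ M) ?linear_sum// => i; apply: MP.
Qed.

Variables (S : set T) (subS : subspace S) (h : nat) (u : V).
Hypothesis uh : homog (voa_gr V) h u.

(** Removing u_(-1) from w1 leaves modes u_i with i >= 0 on w2, which give a smaller total weight,
    and modes u_(-1-i) on the product. *)
Lemma pairing_left w1 w2 :
  (forall i : nat, S (\sum_(q <- Q) phi (gm_Y T (-1 - i%:Z) u (B w1 w2 (q - (h + i)%N%:R))))) ->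
  (forall i : nat, S (pairing w1 (gm_Y W2 i%:Z u w2))) ->
  S (pairing (gm_Y W1 (-1) u w1) w2).
Proof.
move=> Sphi SB; rewrite /pairing.
under eq_bigr do rewrite (intertwining_iterate _ _ _ uh) linearB.
rewrite sumrB; apply: subspaceB => //.
  apply: fsum_pairing => // [q|i].
    have [M MP] := im_truncation imB w1 w2 (q - h%:R).
    exists M => i /MP e; rewrite rmorphD /= -!pmulrn opprD addrA e.
    by rewrite linear0r scaler0.
  under eq_bigr do rewrite linearZ_LR.
  by rewrite -scaler_sumr; apply: subspaceZ => //; apply: Sphi.
apply: fsum_pairing => // [q|i].
  have [N NP] := va_truncation (gm_action W2) u w2.
  exists `|N|%N => i Ni; rewrite NP ?linear0r ?scaler0//; last by lia.
under eq_bigr do rewrite linearZ_LR.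
by rewrite -scaler_sumr; apply: subspaceZ => //; apply: SB.
Qed.

(** The mirror image, from the commutator formula at k = -1: now u_(-1) is the only mode acting on
    the product. *)
Lemma pairing_right w1 w2 :
  S (\sum_(q <- Q) phi (gm_Y T (-1) u (B w1 w2 (q - h%:R)))) ->
  (forall i : nat, S (pairing (gm_Y W1 i%:Z u w1) w2)) ->
  S (pairing w1 (gm_Y W2 (-1) u w2)).
Proof.
move=> Sphi SB; rewrite /pairing.
have e q : B w1 (gm_Y W2 (-1) u w2) q = gm_Y T (-1) u (B w1 w2 (q - h%:R)) -
    \sum_(i \in [set: nat]) (subexp R (i%:Z - -1 - 1) i * z ^ (-1 - i%:Z))
      *: B (gm_Y W1 i%:Z u w1) w2 q.
  apply/eqP; rewrite eq_sym subr_eq; apply/eqP; rewrite [RHS]addrC -(intertwining_commutator _ _ _ _ uh).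
  by rewrite (_ : h%:Z - -1 - 1 = h)// ; lia.
under eq_bigr do rewrite e linearB.
rewrite sumrB; apply: subspaceB => //; apply: fsum_pairing => // [q|i].
  have [N NP] := va_truncation (gm_action W1) u w1.
  exists `|N|%N => i Ni; rewrite NP ?linear0l ?scaler0//; last by lia.
under eq_bigr do rewrite linearZ_LR.
by rewrite -scaler_sumr; apply: subspaceZ => //; apply: SB.
Qed.
End Functional.
End Intertwining.

Section Reduction.
Variables (R : realType) (V : voa R).
Local Notation C := R[i].

(* A letter (u, h, i) stands for the operator u_(-1-i), of weight h + i. *)
Definition word := seq (V * nat * nat).

Definition word_act (T : genmod V) (s : word) (t : T) : T :=
  foldr (fun l t => gm_Y T (-1 - l.2%:Z) l.1.1 t) t s.

Definition word_weight (s : word) : nat := \sum_(l <- s) (l.1.2 + l.2).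

(** The room below Q: modes of total weight above d that land in a degree of Q start from a zero
    component. *)
Definition depth_le (T : genmod V) (Q : seq C) (d : nat) :=
  forall q k (t : T), q \in Q -> (d < k)%N -> homog (gm_gr T) (q - k%:R) t -> t = 0.

(** The finite alphabet for depth d. Each vector is tagged with its positive weight, as the words
    must record weights. *)
Lemma voa_homog_basis (d : nat) : exists b : seq (V * nat),
  (forall x, x \in b -> homog (voa_gr V) x.2 x.1 /\ (0 < x.2)%N) /\
  forall h, (0 < h <= d)%N -> homog (voa_gr V) h `<=` lspan [set u | (u, h) \in b].
Proof.
elim: d => [|d [b [bP bS]]]; first by exists [::]; split=> // h; lia.
have [s sP] := @voa_findim _ V d.+1.
have [t tS tP] := subspace_basis (homog_subspace (voa_gr V) d.+1) sP.
exists (b ++ [seq (u, d.+1) | u <- t]); split=> [x|h].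
  by rewrite mem_cat => /orP[/bP//|/mapP[u ut ->]]; split=> //; apply: tS.
move=> /andP[h0]; rewrite leq_eqVlt => /orP[/eqP ->|hd] u uh.
  apply: lspan_mono (tP u uh) => y /= yt; rewrite mem_cat; apply/orP; right.
  exact: (map_f (fun u => (u, d.+1))).
have hd' : (0 < h <= d)%N by rewrite h0 -ltnS.
by apply: lspan_mono (bS h hd' u uh) => y /= yt; rewrite mem_cat yt.
Qed.

Variables (z : C) (W1 W2 : genmod V) (M1 : seq W1) (M2 : seq W2).
Hypothesis W1_lower : lower_truncated W1.
Hypothesis W2_lower : lower_truncated W2.
Hypothesis M1_gen : C1_generators M1.
Hypothesis M2_gen : C1_generators M2.

Section Bounded.
Variables (T : genmod V) (B : {bilinear W1 -> W2 -> (C -> T)}).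
Hypothesis imB : intertwining_map z B.
Variables (phi : {linear T -> T}) (Q : seq C) (S : set T).
Hypothesis subS : subspace S.
Hypothesis S_gen : forall m1 m2, m1 \in M1 -> m2 \in M2 -> S (pairing B phi Q m1 m2).
Hypothesis S_raise : forall (h i : nat) u w1 w2, (0 < h)%N -> homog (voa_gr V) h u ->
  S (\sum_(q <- Q) phi (gm_Y T (-1 - i%:Z) u (B w1 w2 (q - (h + i)%N%:R)))).

(* Each of the two intertwining relations trades u_(-1) acting on w1 or w2 for
   terms of smaller total weight and for modes of u acting on the product. *)
Lemma pairing_closed w1 w2 : S (pairing B phi Q w1 w2).
Proof.
have [r1 P1] := W1_lower; have [r2 P2] := W2_lower.
have linl w : subspace [set x | S (pairing B phi Q x w)].
  exact: subspace_preim (pairing_linearl _ _ _ _) subS.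
have linr w : subspace [set x | S (pairing B phi Q w x)].
  exact: subspace_preim (pairing_linearr _ _ _ _) subS.
(* The total weight is measured by real parts, in unit steps above r1 + r2; at e = 0 one of the two
   vectors lies below its truncation bound and vanishes. *)
have S_homog (e : nat) : forall n1 n2 x1 x2, homog (gm_gr W1) n1 x1 ->
    homog (gm_gr W2) n2 x2 -> complex.Re n1 + complex.Re n2 < r1 + r2 + e%:R ->
    S (pairing B phi Q x1 x2).
  elim: e => [|e IH] n1 n2 x1 x2 h1 h2 en.
    have [l1|l1] := ltrP (complex.Re n1) r1.
      by rewrite -h1 P1//; apply: (subspace0 (linl x2)).
    have l2 : complex.Re n2 < r2 by move: en l1; rewrite addr0; lra.
    by rewrite -h2 P2//; apply: (subspace0 (linr x1)).
  have Re_shift (h i : nat) : complex.Re ((h%:Z - i%:Z - 1)%:~R : C) = h%:R - i%:R - 1.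
    by rewrite Re_int !rmorphB /= -!pmulrn.
  have i0 (i : nat) : 0 <= i%:R :> R by [].
  have [c1 [e1 [Cc1 Ce1 ->]]] := M1_gen h1.
  apply: (subspaceD (linl x2)).
    apply: (lspan_min (linl x2)) Cc1 => _ [h [u [w [h0 uh wh ->]]]] /=.
    apply: (pairing_left imB subS uh) => i; first exact: S_raise.
    apply: (IH _ _ _ _ wh (homog_op i uh h2)); rewrite ReB ReD Re_shift Re_nat.
    by move: en (i0 i); rewrite -natr1; lra.
  apply: (lspan_min (linl x2)) Ce1 => m1 [m1M m1h] /=.
  have [c2 [e2 [Cc2 Ce2 ->]]] := M2_gen h2.
  apply: (subspaceD (linr m1)).
    apply: (lspan_min (linr m1)) Cc2 => _ [h [u [w [h0 uh wh ->]]]] /=.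
    apply: (pairing_right imB subS uh) => [|i].
      by have := S_raise 0 m1 w h0 uh; rewrite addn0.
    apply: (IH _ _ _ _ (homog_op i uh m1h) wh); rewrite ReB ReD Re_shift Re_nat.
    by move: en (i0 i); rewrite -natr1; lra.
  by apply: (lspan_min (linr m1)) Ce2 => m2 [m2M _]; apply: S_gen.
apply: (grading_ind (g := gm_gr W1) (linl w2)) => n1 /=.
apply: (grading_ind (g := gm_gr W2) (linr _)) => n2 /=.
have [e eP] := nat_gt (complex.Re n1 + complex.Re n2 - r1 - r2).
apply: (S_homog e n1 n2 _ _ (homog_gproj _ _ _) (homog_gproj _ _ _)).
by move: eP; lra.
Qed.
End Bounded.

(* Induction on d: the modes of u acting on the product consume the depth of Q. *)
Lemma pairing_words d : exists L : seq word,
  forall (T : genmod V) (B : {bilinear W1 -> W2 -> (C -> T)}) (phi : {linear T -> T})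
    (Q : seq C) (S : set T), intertwining_map z B -> subspace S -> depth_le T Q d ->
  (forall s m1 m2, s \in L -> m1 \in M1 -> m2 \in M2 ->
     S (\sum_(q <- Q) phi (word_act s (B m1 m2 (q - (word_weight s)%:R))))) ->
  forall w1 w2, S (pairing B phi Q w1 w2).
Proof.
have deep (T : genmod V) (B : {bilinear W1 -> W2 -> (C -> T)}) (phi : {linear T -> T})
    (Q : seq C) (S : set T) e (k h i : _) u w1 w2 : intertwining_map z B -> subspace S ->
    depth_le T Q e -> (e < h + i)%N ->
    S (\sum_(q <- Q) phi (gm_Y T k u (B w1 w2 (q - (h + i)%N%:R)))).
  move=> imB subS dQ ehi; rewrite big_seq big1 => [|q qQ]; first exact: subspace0.
  by rewrite (dQ q (h + i)%N (B w1 w2 _) qQ ehi (im_completion imB _ _ _)) linear0r linear0.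
elim: d => [|d [L' L'P]].
  (* At depth 0 every mode on the product has positive weight and contributes nothing, so the empty
     word suffices. *)
  exists [:: [::]] => T B phi Q S imB subS dQ test; apply: pairing_closed => //.
    move=> m1 m2 m1M m2M; have := test [::] m1 m2 (mem_head _ _) m1M m2M.
    by rewrite /word_weight big_nil /pairing; under eq_bigr do rewrite subr0.
  by move=> h i u w1 w2 h0 _; apply: deep dQ _ => //; rewrite addn_gt0 h0.
have [b [bP bS]] := voa_homog_basis d.+1.
(* A first letter (u, h, i) matters only if h + i <= d + 1; as h > 0, this leaves i <= d. *)
exists ([::] :: [seq l :: s | l <- [seq (p, i) | p <- b, i <- iota 0 d.+1], s <- L']).
move=> T B phi Q S imB subS dQ test; apply: pairing_closed => //.
  move=> m1 m2 m1M m2M; have := test [::] m1 m2 (mem_head _ _) m1M m2M.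
  by rewrite /word_weight big_nil /pairing; under eq_bigr do rewrite subr0.
move=> h i u w1 w2 h0 uh.
have [hid|hid] := leqP (h + i) d.+1; last exact: deep dQ hid.
have hd : (0 < h <= d.+1)%N by rewrite h0 (leq_trans (leq_addr i h)).
apply: (@lspan_min _ _ _ [set u | S (\sum_(q <- Q) phi (gm_Y T (-1 - i%:Z) u
  (B w1 w2 (q - (h + i)%N%:R))))]) (bS h hd u uh).
  apply: subspace_preim subS => a x y; rewrite scaler_sumr -big_split.
  by apply: eq_bigr => q _ /=; rewrite linearPl [LHS]linearP.
(* The mode is absorbed into the functional: phi becomes phi after v_(-1-i), and Q moves down by h +
   i >= 1, so the depth drops. This is why phi and Q are quantified inside the induction. *)
move=> v /= vb; pose Q' := [seq q - (h + i)%N%:R | q <- Q].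
have comp_linear : linear (fun t => phi (gm_Y T (-1 - i%:Z) v t)).
  by move=> a x y; rewrite linearPr [LHS]linearP.
pose psi := mk_linear comp_linear.
have dQ' : depth_le T Q' d.
  move=> _ k t /mapP[q qQ ->] dk; rewrite -addrA -opprD -natrD.
  by apply: dQ qQ _; lia.
have := L'P T B psi Q' S imB subS dQ' _ w1 w2.
rewrite /pairing big_map; apply=> s m1 m2 sL m1M m2M.
have sL' : (v, h, i) :: s \in [::] ::
    [seq l :: s | l <- [seq (p, i) | p <- b, i <- iota 0 d.+1], s <- L'].
  rewrite inE orbC allpairs_f// (allpairs_f (fun p i => (p, i)))// mem_iota.
  by rewrite add0n /=; lia.
have := test _ m1 m2 sL' m1M m2M; rewrite big_map /word_weight big_cons /=.
by under eq_bigr do rewrite natrD opprD addrA.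
Qed.
End Reduction.

(** * The action on completions, and intertwining maps into submodules and direct sums *)

Section Completions.
Variables (R : realType) (V : voa R) (T : genmod V) (f : R[i] -> T).
Local Notation C := R[i].
Hypothesis fP : in_completion f.

Lemma completed_support k (v : V) n :
  finite_set [set p | gm_gr T n (gm_Y T k v (f p)) != 0].
Proof.
have [r ur rP] := grading_support (voa_gr V) v.
apply: (@sub_finite_set _ _ [set` [seq n - (h - k - 1)%:~R | h <- r]]) => // p /=.
apply: contraR => pr; rewrite (gproj_seq ur rP) linear_sumlz linear_sum big_seq big1// => h hr.
rewrite /= (gproj_homog _ (homog_op k (homog_gproj _ h v) (fP p))).
case: eqVneq => // nE; exfalso; move/negP: pr; apply; apply/mapP; exists h => //.
by rewrite nE addrK.
Qed.

Lemma completed_op_linear k n : linear (fun v => completed_op k v f n).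
Proof.
apply: (@fsum_linear _ _ _ _ (fun p v => gm_gr T n (gm_Y T k v (f p)))).
  by move=> p a x y; rewrite linearPl linearP.
by move=> v; apply: completed_support.
Qed.

Lemma completed_op_trunc (a : int) v n :
  (forall p, exists M : nat, forall m : nat, (M <= m)%N -> f (p - m%:R) = 0) ->
  exists M : nat, forall i : nat, (M <= i)%N -> completed_op (a - i%:Z) v f n = 0.
Proof.
move=> fT; pose E : set V := [set v | exists M : nat, forall i : nat, (M <= i)%N ->
  completed_op (a - i%:Z) v f n = 0].
apply: (grading_ind (g := voa_gr V) (S := E)).
  split; first by exists 0%N => i _; apply: fsum0 => p; rewrite linear0l linear0.
  move=> c x y [M MP] [N NP]; exists (maxn M N) => i; rewrite geq_max => /andP[/MP ex /NP ey].
  by rewrite completed_op_linear ex ey scaler0 addr0.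
move=> h; have [M MP] := fT (n - (h - a - 1)%:~R); exists M => i Mi.
rewrite (completed_op_homog _ _ (homog_gproj _ h v) fP).
rewrite (_ : n - _ = n - (h - a - 1)%:~R - i%:R) ?MP ?linear0r//.
by rewrite (pmulrn _ i) -[RHS]addrA -opprD -intrD; congr (_ - _%:~R); lia.
Qed.
End Completions.

Lemma completed_op_morph (R : realType) (V : voa R) (A B : genmod V) (g : {linear A -> B})
    k (v : V) (f : R[i] -> A) n :
  (forall k u x, g (gm_Y A k u x) = gm_Y B k u (g x)) ->
  (forall n x, g (gm_gr A n x) = gm_gr B n (g x)) ->
  in_completion f -> g (completed_op k v f n) = completed_op k v (g \o f) n.
Proof.
move=> gY gpr fP; rewrite /completed_op fsum_morph; last exact: completed_support.
by apply: eq_fsum => p; rewrite /= gpr gY.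
Qed.

Section JointIntertwining.
Variables (R : realType) (V : voa R) (z : R[i]) (W1 W2 Q A1 A2 : genmod V).
Local Notation C := R[i].
Variables (g1 : {linear Q -> A1}) (g2 : {linear Q -> A2}).
Hypothesis g1Y : forall k u x, g1 (gm_Y Q k u x) = gm_Y A1 k u (g1 x).
Hypothesis g2Y : forall k u x, g2 (gm_Y Q k u x) = gm_Y A2 k u (g2 x).
Hypothesis g1pr : forall n x, g1 (gm_gr Q n x) = gm_gr A1 n (g1 x).
Hypothesis g2pr : forall n x, g2 (gm_gr Q n x) = gm_gr A2 n (g2 x).
Hypothesis ginj : forall x, g1 x = 0 -> g2 x = 0 -> x = 0.
Variables (J : {bilinear W1 -> W2 -> (C -> Q)}).
Variables (B1 : {bilinear W1 -> W2 -> (C -> A1)}) (B2 : {bilinear W1 -> W2 -> (C -> A2)}).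
Hypothesis g1J : forall w1 w2 n, g1 (J w1 w2 n) = B1 w1 w2 n.
Hypothesis g2J : forall w1 w2 n, g2 (J w1 w2 n) = B2 w1 w2 n.
Hypothesis imB1 : intertwining_map z B1.
Hypothesis imB2 : intertwining_map z B2.

Let J_completion w1 w2 : in_completion (J w1 w2).
Proof.
move=> n; apply: (joint_eq ginj).
  by rewrite g1pr g1J; apply: (im_completion imB1).
by rewrite g2pr g2J; apply: (im_completion imB2).
Qed.

Let J_truncation w1 w2 n :
  exists M : nat, forall m : nat, (M <= m)%N -> J w1 w2 (n - m%:R) = 0.
Proof.
have [M1 P1] := im_truncation imB1 w1 w2 n; have [M2 P2] := im_truncation imB2 w1 w2 n.
exists (maxn M1 M2) => m; rewrite geq_max => /andP[/P1 e1 /P2 e2].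
by apply: ginj; rewrite ?g1J ?g2J.
Qed.

Let image_jacobi (A : genmod V) (g : {linear Q -> A}) (B : {bilinear W1 -> W2 -> (C -> A)})
    v w1 w2 (l m : int) n :
  (forall k u x, g (gm_Y Q k u x) = gm_Y A k u (g x)) ->
  (forall n x, g (gm_gr Q n x) = gm_gr A n (g x)) ->
  (forall w1 w2 n, g (J w1 w2 n) = B w1 w2 n) -> intertwining_map z B ->
  g (\sum_(i \in [set: nat])
        (subexp R l i * z ^+ i) *: completed_op (l + m - i%:Z) v (J w1 w2) n)
  = g ((\sum_(i \in [set: nat])
        (subexp R (i%:Z - m - 1) i * z ^ (m - i%:Z))
          *: J (gm_Y W1 (l + i%:Z) v w1) w2 n)
    + \sum_(i \in [set: nat])
        ((-1) ^ l * subexp R l i * z ^ (l - i%:Z))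
          *: J w1 (gm_Y W2 (m + i%:Z) v w2) n).
Proof.
move=> gY gpr gJ imB; rewrite linearD fsum_morph; last first.
  have [M MP] := completed_op_trunc (J_completion w1 w2) (l + m) v n (J_truncation w1 w2).
  by apply: (@finite_support_nat _ _ M) => i /MP ->; rewrite scaler0.
rewrite fsum_morph; last first.
  have [N NP] := va_truncation (gm_action W1) v w1.
  apply: (@finite_support_nat _ _ `|N - l|%N) => i Ni.
  by rewrite NP ?linear0l ?scaler0//; lia.
rewrite fsum_morph; last first.
  have [N NP] := va_truncation (gm_action W2) v w2.
  apply: (@finite_support_nat _ _ `|N - m|%N) => i Ni.
  by rewrite NP ?linear0r ?scaler0//; lia.
have := im_jacobi imB v w1 w2 l m n; congr (_ = _ + _); apply: eq_fsum => i;
  rewrite /= linearZ /= ?gJ//.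
have <- : g \o J w1 w2 = B w1 w2 by apply/funext => p /=.
by rewrite (completed_op_morph (g := g)).
Qed.

Lemma joint_intertwining : intertwining_map z J.
Proof.
split=> // v w1 w2 l m n; apply: (joint_eq ginj).
  exact: image_jacobi imB1.
exact: image_jacobi imB2.
Qed.
End JointIntertwining.

(** * A bound uniform in the target module, and its maximum *)

Section Universal.
Variables (R : realType) (V : voa R) (P : seq R[i]).
Local Notation C := R[i].
Hypothesis HP : @lowest_weights R V P.

(** A nonzero vector of weight q - k lies a natural number j above some p' in P, so q - p' = k + j.
    The finitely many differences of elements of P bound k, whatever T is. *)
Lemma lowest_weights_depth : exists D : nat, forall T : genmod V,
  lower_truncated T -> depth_le T P D.
Proof.
have /choice[g gP] : forall p : C, exists M, forall p' i, p' \in P -> (M <= i)%N ->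
    p - i%:R != p'.
  move=> p; apply: (common_bound P (Q := fun p' i => p - i%:R != p')) => p'.
  have [M MP] := nat_gt (complex.Re p - complex.Re p').
  exists M => i Mi; apply: contraTneq MP => <-; rewrite ReB Re_nat subKr -leNgt.
  by rewrite ler_nat.
have [D DP] : exists D, forall p i, p \in P -> (D <= i)%N ->
    forall p', p' \in P -> p - i%:R != p'.
  apply: (common_bound P (Q := fun p i => forall p', p' \in P -> p - i%:R != p')) => p.
  by exists (g p) => i Mi p' pP; apply: gP.
exists D => T Tl q k t qP Dk tk; apply/eqP; apply: contraT => t0.
have [j [jP _]] := HP Tl (@submoduleT _ _ T) t0 I tk.
have := DP q (k + j)%N qP (leq_trans (ltnW Dk) (leq_addr j k)) _ jP.
by rewrite natrD opprD addrA eqxx.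
Qed.

Variables (z : C) (W1 W2 : genmod V) (M1 : seq W1) (M2 : seq W2).
Hypothesis W1_lower : lower_truncated W1.
Hypothesis W2_lower : lower_truncated W2.
Hypothesis M1_gen : C1_generators M1.
Hypothesis M2_gen : C1_generators M2.

(** N counts the test vectors: one for each degree in P, each word, and each pair of generators from
    M1 and M2. *)
Lemma im_span_bound : exists N : nat,
  forall (T : genmod V) (B : {bilinear W1 -> W2 -> (C -> T)}) k (f : 'I_k -> T),
  lower_truncated T -> intertwining_map z B ->
  (forall i, im_span B (f i) /\ part P (f i)) -> indep f -> (k <= N)%N.
Proof.
have [D DP] := lowest_weights_depth.
have [L LP] := pairing_words z W1_lower W2_lower M1_gen M2_gen D.
exists (size P * (size L * (size M1 * size M2)))%N => T B k f Tl imB fP indf.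
pose tests := [seq gm_gr T x.1 (word_act x.2.1
   (B x.2.2.1 x.2.2.2 (x.1 - (word_weight x.2.1)%:R))) |
   x <- [seq (p, y) | p <- P, y <- [seq (s, m) | s <- L, m <-
     [seq (m1, m2) | m1 <- M1, m2 <- M2]]]].
pose S := lspan [set` tests].
have subS : subspace S := subspace_lspan _.
(* The reduction is applied one degree at a time, with Q = {p} and phi the projection to degree
   p. *)
have SB p w1 w2 : p \in P -> S (B w1 w2 p).
  move=> pP; have dp : depth_le T [:: p] D.
    by move=> q j t; rewrite inE => /eqP ->; apply: DP.
  have := LP T B (gm_gr T p) [:: p] S imB subS dp _ w1 w2.
  rewrite /pairing big_seq1 (im_completion imB); apply=> s m1 m2 sL m1M m2M.
  rewrite big_seq1; apply: lspan_gen => /=; apply/mapP.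
  exists (p, (s, (m1, m2))) => //; apply: allpairs_f => //; apply: allpairs_f => //.
  exact: allpairs_f.
have -> : (size P * (size L * (size M1 * size M2)))%N = size tests.
  by rewrite size_map !size_allpairs.
apply: indep_le indf => i; have [fI fp] := fP i.
rewrite (part_sum fp) big_seq; apply: subspace_sum => // p; rewrite mem_undup => pP.
apply: (@lspan_min _ _ _ [set t | S (gm_gr T p t)]) fI.
  exact: subspace_preim (linearP _) subS.
move=> _ [w1 [w2 [n ->]]] /=; rewrite (gproj_homog _ (im_completion imB w1 w2 n)).
by case: eqVneq => [<-|_]; [apply: SB|apply: subspace0].
Qed.

Hypothesis W1_restr : grading_restricted W1.

(** A predicate on numbers, so that the maximum is taken over k and not over modules. An inequality
    is encoded: k independent vectors, not an exact dimension. *)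
Definition attained (k : nat) := exists (T : genmod V)
  (B : {bilinear W1 -> W2 -> (C -> T)}) (f : 'I_k -> T),
  [/\ grading_restricted T, intertwining_map z B,
      forall i, im_span B (f i) /\ part P (f i) & indep f].

Lemma attained0 : attained 0.
Proof.
have bil0 : bilinear_for *:%R *:%R (fun (_ : W1) (_ : W2) => (0 : C -> W1)).
  by split=> [w a x y|w a x y]; rewrite /= scaler0 addr0.
(* The zero map; W1 merely serves as an available object of the category. *)
exists W1, (mk_bilinear bil0), (fun=> 0); split=> //; last by move=> c _ [].
  split=> [w1 w2 n|w1 w2 n|v w1 w2 l m n]; first exact: linear0.
    by exists 0%N.
  rewrite !fsum0 ?addr0// => i; rewrite ?scaler0//=.
  by rewrite /completed_op fsum0 ?scaler0// => p; rewrite linear0r linear0.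
by case.
Qed.

Lemma attained_max : exists2 k, attained k & forall j, attained j -> (j <= k)%N.
Proof.
have [N NP] := im_span_bound.
have exA : exists k, `[< attained k >] by exists 0%N; apply/asboolP/attained0.
have leN k : `[< attained k >] -> (k <= N)%N.
  by move=> /asboolP[T [B [f [[Tl _] imB fP indf]]]]; apply: NP Tl imB fP indf.
case: (ex_maxnP exA leN) => k /asboolP Ak kmax; exists k => // j Aj.
by apply: kmax; apply/asboolP.
Qed.
End Universal.

Section Corestriction.
Variables (R : realType) (V : voa R) (z : R[i]) (W1 W2 W : genmod V).
Local Notation C := R[i].
Variables (B : {bilinear W1 -> W2 -> (C -> W)}) (imB : intertwining_map z B).
Local Notation T := (sub_genmod (im_span_submodule imB)).
Local Notation incl := (sub_incl (im_span_submodule imB)).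

Lemma im_span_gen w1 w2 n : im_span B (B w1 w2 n).
Proof. by apply: lspan_gen; do 3!eexists. Qed.

Definition corestr_fun w1 w2 : C -> T :=
  fun n => sub_elt (im_span_submodule imB) (im_span_gen w1 w2 n).

Lemma corestr_bilinear : bilinear_for *:%R *:%R corestr_fun.
Proof.
split=> [w a x y|w a x y]; apply/funext => n; apply: sub_incl_inj => /=.
  by rewrite linearPl.
by rewrite linearPr.
Qed.

Definition corestr : {bilinear W1 -> W2 -> (C -> T)} := mk_bilinear corestr_bilinear.

Lemma corestr_intertwining : intertwining_map z corestr.
Proof.
apply: (@joint_intertwining _ _ _ _ _ _ _ _ incl incl _ _ _ _ _ _ B B) => //.
by move=> x x0 _; apply: sub_incl_inj; rewrite x0 linear0.
Qed.

(** Being spanned by the components of the product gives T both halves of the universal property: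
    the graph below is defined on all of T, and module maps out of T are determined by their values
    on products. *)
Lemma corestr_im_span t : im_span corestr t.
Proof.
have subI : subspace (im_span corestr) := subspace_lspan _.
have : exists2 t', incl t' = incl t & im_span corestr t'.
  apply: (@lspan_min _ _ _ [set x | exists2 t', incl t' = x & im_span corestr t'])
    (sub_inclP t).
    split=> [|a _ _ [x <- Ix] [y <- Iy]].
      by exists 0; [rewrite linear0|apply: subspace0].
    by exists (a *: x + y); [rewrite linearP|apply: subspaceD => //; apply: subspaceZ].
  move=> _ [w1 [w2 [n ->]]]; exists (corestr w1 w2 n) => //.
  by apply: lspan_gen; do 3!eexists.
by case=> t' /sub_incl_inj ->.
Qed.
End Corestriction.

Section Pairing.
Variables (R : realType) (V : voa R) (z : R[i]) (W1 W2 A1 A2 : genmod V).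
Local Notation C := R[i].
Variables (B1 : {bilinear W1 -> W2 -> (C -> A1)}) (B2 : {bilinear W1 -> W2 -> (C -> A2)}).
Hypothesis imB1 : intertwining_map z B1.
Hypothesis imB2 : intertwining_map z B2.

Definition pair_fun w1 w2 : C -> sum_genmod A1 A2 := fun n => (B1 w1 w2 n, B2 w1 w2 n).

Lemma pair_bilinear : bilinear_for *:%R *:%R pair_fun.
Proof.
by split=> [w a x y|w a x y]; apply/funext => n; rewrite /pair_fun ?linearPl ?linearPr.
Qed.

Definition pair_map : {bilinear W1 -> W2 -> (C -> sum_genmod A1 A2)} :=
  mk_bilinear pair_bilinear.

Lemma pair_intertwining : intertwining_map z pair_map.
Proof.
apply: (@joint_intertwining _ _ _ _ _ _ _ _ (sum_pr1 A1 A2) (sum_pr2 A1 A2)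
  _ _ _ _ _ _ B1 B2) => //.
exact: sum_joint_inj.
Qed.
End Pairing.

(** * The tensor product *)

Section Existence.
Variables (R : realType) (V : voa R) (P : seq R[i]) (z : R[i]) (W1 W2 : genmod V).
Local Notation C := R[i].
Hypothesis HP : @lowest_weights R V P.
Variables (k : nat) (U : genmod V) (B0 : {bilinear W1 -> W2 -> (C -> U)}) (f0 : 'I_k -> U).
Hypothesis U_restr : grading_restricted U.
Hypothesis imB0 : intertwining_map z B0.
Hypothesis f0P : forall i, im_span B0 (f0 i) /\ part P (f0 i).
Hypothesis f0_indep : indep f0.
Hypothesis k_max : forall j, attained P z W1 W2 j -> (j <= k)%N.

Local Notation T := (sub_genmod (im_span_submodule imB0)).
Local Notation B := (corestr imB0).

Lemma corestr_indep : exists2 f : 'I_k -> T, (forall i, part P (f i)) & indep f.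
Proof.
exists (fun i => sub_elt (im_span_submodule imB0) (f0P i).1) => [i n nP|].
  apply: sub_incl_inj; rewrite sub_incl_gr sub_eltK linear0.
  exact: (f0P i).2.
exact: (indep_lift (g := sub_incl (im_span_submodule imB0))).
Qed.

Section Factorization.
Variables (W : genmod V) (I : {bilinear W1 -> W2 -> (C -> W)}).
Hypothesis W_restr : grading_restricted W.
Hypothesis imI : intertwining_map z I.

Local Notation J := (pair_map B I).
Let imJ : intertwining_map z J.
Proof. exact: pair_intertwining (corestr_intertwining imB0) imI. Qed.

Let subJ : submodule (im_span J). Proof. exact: im_span_submodule imJ. Qed.

(** The projection of the span of J to T has in its image all components of B, and these span T. *)
Lemma graph_total (t : T) : exists w, im_span J (t, w).
Proof.
have [x Jx <-] : exists2 x, im_span J x & x.1 = t; last by exists x.2; case: x Jx.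
suff sub : im_span B `<=` [set t : T | exists2 x, im_span J x & x.1 = t].
  exact: sub (corestr_im_span t).
apply: lspan_min.
  have subI := submodule_subspace subJ.
  split=> [|a _ _ [x Jx <-] [y Jy <-]]; first by exists 0 => //; apply: subspace0.
  by exists (a *: x + y) => //; apply: subspaceD => //; apply: subspaceZ.
move=> _ [w1 [w2 [n ->]]]; exists (J w1 w2 n) => //.
exact: im_span_gen.
Qed.

(* A nonzero kernel would meet the part of J in the degrees P, against the
   maximality of k. *)
Lemma graph_functional w : im_span J (0, w) -> w = 0.
Proof.
move=> Jw; apply/eqP; apply: contraT => w0.
have Q_restr : grading_restricted (sum_genmod T W).
  by apply: sum_grading_restricted => //; apply: sub_grading_restricted.
pose K : set (sum_genmod T W) := [set x | im_span J x /\ x.1 = 0].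
have subK : submodule K.
  case: subJ => J0 JP JY; split=> [|a x y [Jx x0] [Jy y0]|n u x [Jx x0]].
  - by split.
  - by split; [apply: JP|rewrite /= x0 y0 scaler0 addr0].
  - by split; [apply: JY|rewrite /= x0 -[LHS]/(gm_Y T n u 0) linear0r].
have Kw : K (0, w) by split.
have Kw0 : (0, w) != 0 :> sum_genmod T W by apply: contraNneq w0 => -[->].
have [a [[Ja a1] a0 aP]] := submodule_part HP subK Q_restr.1 Kw0 Kw.
have [f fP indf] := corestr_indep.
(* Cutting a point (f i, v) of the graph down to the degrees in P keeps it in the submodule and does
   not move f i, which already lies in these degrees. *)
have /choice[g gP] : forall i, exists x, [/\ im_span J x, part P x & x.1 = f i].
  move=> i; have [v Jv] := graph_total (f i).
  exists (\sum_(p <- undup P) gm_gr (sum_genmod T W) p (f i, v)); split.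
  - apply: (subspace_sum (submodule_subspace subJ)) => p _.
    exact: (submodule_gproj p subJ Jv).
  - exact: part_proj.
  - rewrite -[LHS]/(sum_pr1 T W _) linear_sum [RHS](part_sum (fP i)).
    by apply: eq_bigr.
(* The lifts g i together with a, which projects to 0 in T, are k + 1 independent vectors for the
   intertwining map J. *)
have : (k.+1 <= k)%N by apply: k_max; exists (sum_genmod T W), J,
    (fun i => oapp g a (unlift ord0 i)); split => //;
  [move=> i; case: unliftP => [j _|_] /=; [by case: (gP j)|by []]
  |apply: (indep_ker (g := sum_pr1 T W)) => //;
   rewrite (_ : _ \o g = f)//; apply/funext => i; case: (gP i)].
by rewrite ltnn.
Qed.

Lemma graph_eq t w w' : im_span J (t, w) -> im_span J (t, w') -> w = w'.
Proof.
move=> Jw Jw'; apply/eqP; rewrite -subr_eq0; apply/eqP/graph_functional.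
have -> : (0, w - w') = (t, w) - (t, w') :> sum_genmod T W.
  by rewrite -[RHS]/(t - t, w - w') subrr.
exact: (subspaceB (submodule_subspace subJ) Jw Jw').
Qed.

(** The span of J is the graph of eta, and its being a submodule says that eta is a module map. *)
Lemma factorization : exists! eta : T -> W, module_map eta /\
  forall w1 w2, I w1 w2 = completed_map eta (B w1 w2).
Proof.
have /choice[eta etaP] := graph_total.
case: (subJ) => J0 JP JY.
have etaB w1 w2 n : eta (B w1 w2 n) = I w1 w2 n.
  by apply: graph_eq (etaP _) _; apply: (im_span_gen J w1 w2 n).
exists eta; split.
  split; last by move=> w1 w2; apply/funext => n; rewrite /completed_map etaB.
  split=> [a x y|n v x].
    by apply: graph_eq (etaP _) _; apply: (JP a _ _ (etaP x) (etaP y)).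
  by apply: graph_eq (etaP _) _; apply: (JY n v _ (etaP x)).
(* Uniqueness: eta' and eta agree on a subspace that contains the components of B. *)
move=> eta' [[lin' _] eta'B]; apply/funext => t.
pose E := [set t : T | eta' t = eta t].
have lin : linear eta.
  by move=> a x y; apply: graph_eq (etaP _) _; apply: (JP a _ _ (etaP x) (etaP y)).
have subE : subspace E.
  have sub0 : subspace [set 0 : W] by split=> // a x y -> ->; rewrite /= scaler0 addr0.
  have lind : linear (fun t => eta' t - eta t).
    by move=> a x y; rewrite lin lin' scalerBr opprD addrACA.
  rewrite (_ : E = [set t | [set 0 : W] (eta' t - eta t)]).
    exact: subspace_preim lind sub0.
  apply/seteqP; rewrite /E; split=> x /= xE; first by rewrite xE subrr.
  by apply/eqP; rewrite -subr_eq0; apply/eqP.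
suff : E t by rewrite /E /= => ->.
apply: (lspan_min subE) (corestr_im_span t) => _ [w1 [w2 [n ->]]].
by rewrite /E /= etaB (eta'B w1 w2).
Qed.
End Factorization.

Lemma corestr_tensor_product : tensor_product (@grading_restricted R V) z B.
Proof.
split; [exact: sub_grading_restricted|exact: corestr_intertwining|].
by move=> W I W_restr imI; apply: factorization.
Qed.
End Existence.

Theorem corollary4p6 (R : realType) (V : voa R)
  (V_C1 : C1_cofinite_voa V)
  (V_AN : exists N : nat,
    [/\ (0 < N)%N,
        forall (W1 W2 : genmod V) (n1 n2 : R[i]),
          irreducible_module W1 -> irreducible_module W2 ->
          lowest_weight W1 n1 -> lowest_weight W2 n2 ->
          `|complex.Re n1 - complex.Re n2| <= N%:R
      & An_fin_dim V N])
  (V_irr : forall W : genmod V, irreducible_module W ->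
    real_graded W /\ C1_cofinite W)
  (z : R[i]) (z_neq0 : z != 0) (W1 W2 : genmod V)
  (W1_obj : grading_restricted W1) (W2_obj : grading_restricted W2) :
  exists (T : genmod V) (B : {bilinear W1 -> W2 -> (R[i] -> T)}),
    tensor_product (@grading_restricted R V) z B.
Proof.
have [N [_ _ /lowest_weights_finite[P HP]]] := V_AN.
have cofinite (W : genmod V) : grading_restricted W -> C1_cofinite W.
  (* The part in degrees P is spanned by s, so it holds no [(size s).+1] independent vectors. *)
  move=> Wr; have [s sP] := part_fin P Wr.
  apply: (C1_cofinite_of_bound HP (k := (size s).+1)) => // [W' /V_irr[]//|f fP indf].
  by have := indep_le (fun i => sP _ (fP i)) indf; rewrite ltnn.
have [M1 M1_gen] := C1_generators_exist (cofinite _ W1_obj).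
have [M2 M2_gen] := C1_generators_exist (cofinite _ W2_obj).
have [k [U [B [f [U_restr imB fP indf]]]] k_max] :=
  attained_max HP z W1_obj.1 W2_obj.1 M1_gen M2_gen W1_obj.
exists (sub_genmod (im_span_submodule imB)), (corestr imB).
exact (corestr_tensor_product HP U_restr imB fP indf k_max).
Qed.
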